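(* Let $q$ be a prime power, $H_{\mathcal{H}}(X,Y)=Y^q+Y-X^{q+1}\in\mathbb{F}_{q^2}[X,Y]$, and let $\mathcal{C}_{H_{\mathcal{H}}}(\mathcal{P}_{\mathcal{H}},m)\subseteq\mathbb{F}_{q^2}^n$ be a Hermitian code with $m<n=|\mathcal{P}_{\mathcal{H}}|$, where $\mathcal{P}_{\mathcal{H}}=\{(\alpha,\beta)\in\mathbb{F}_{q^2}^2\mid H_{\mathcal{H}}(\alpha,\beta)=0\}$ is the set of all rational points on $H_{\mathcal{H}}$. Then encoding with the algorithm $\mathsf{BivariateMPE}$ described in the context uses $$O\big(\mathsf{M}(m+n)\log(m+n)\big)\subset\tilde{O}(n)$$ operations in $\mathbb{F}_{q^2}$. Unencoding with the algorithm $\mathsf{SemiGridUnencode}$ described in the context uses $$O\big(q\,\mathsf{M}(q^2)\log(q)\big)\subset\tilde{O}(n)$$ operations in $\mathbb{F}_{q^2}$.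
   Context: Codes. Write $\mathbb{F}=\mathbb{F}_{q^2}$ for the field with $q^2$ elements, and $a=\deg_Y H_{\mathcal{H}}=q$, $b=\deg_X H_{\mathcal{H}}=q+1$. The function field $\mathbb{F}(x,y)$ with $H_{\mathcal{H}}(x,y)=0$ has a rational place $P_\infty$ that is the only pole of $x$ and of $y$; $x^iy^j$ has pole order $ai+bj$ there. The other rational places are identified with the points of $\mathcal{P}_{\mathcal{H}}$. Each $f\in\mathbb{F}[x,y]$ has a unique expression with $y$-degree at most $a-1$, its standard form, by which it is lifted to $\mathbb{F}[X,Y]$. For an integer $m\ge0$ the Riemann–Roch space $\mathcal{L}(mP_\infty)$ has basis $B=\{x^iy^j\mid ai+bj\le m,\ j\le a-1\}$. With $\mathcal{P}_{\mathcal{H}}=\{P_1,\dots,P_n\}$, the Hermitian code is $\mathcal{C}_{H_{\mathcal{H}}}(\mathcal{P}_{\mathcal{H}},m)=\{(f(P_1),\dots,f(P_n))\mid f\in\mathcal{L}(mP_\infty)\}$. For $m<n$ evaluation is injective on $\mathcal{L}(mP_\infty)$, and messages are the coefficient vectors on $B$ in some specified order. Encoding a message with corresponding polynomial $f$ in standard form means computing $(f(P_1),\dots,f(P_n))$, which is done by applying $\mathsf{BivariateMPE}$ to $f$ and $\mathcal{P}_{\mathcal{H}}$; unencoding is the inverse: given a codeword $(c_1,\dots,c_n)$, find $f\in\mathcal{L}(mP_\infty)$ in standard form with $f(P_i)=c_i$ for all $i$. Point sets and tables. For $\mathcal{P}\subseteq\mathbb{F}^2$, $\mathcal{X}(\mathcal{P})$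 is the set of $X$-coordinates of points of $\mathcal{P}$ and $\mathcal{Y}_\alpha(\mathcal{P})=\{\beta\mid(\alpha,\beta)\in\mathcal{P}\}$. For finite $\mathcal{A}$, $T\in\mathcal{B}^{\mathcal{A}}$ is a lookup table with stored values $T[a]$. A balanced partition tree of $\mathcal{S}\subseteq\mathbb{F}$ is a binary tree whose nodes are subsets of $\mathcal{S}$, with root $\mathcal{S}$, whose leaves are singletons, and in which each internal node is the disjoint union of its two children, whose cardinalities differ by at most $1$; $\mathcal{T}[\mathcal{N}]$ denotes the set of the two children of $\mathcal{N}$ in $\mathcal{T}$. Classical univariate subroutines: - $\mathsf{UnivariateMPE}(h,\mathcal{S})$ outputs $(h(\alpha))_{\alpha\in\mathcal{S}}$ in $O(\mathsf{M}(\deg h+|\mathcal{S}|)\log(\deg h+|\mathcal{S}|))$ operations. - $\mathsf{UnivariateInterp}_Y(\mathcal{S},\mathcal{F})$, for $\mathcal{F}\in\mathbb{F}^{\mathcal{S}}$, outputs the unique $f\in\mathbb{F}[Y]$ with $\deg f<|\mathcal{S}|$ and $f(\alpha)=\mathcal{F}[\alpha]$ for all $\alpha\in\mathcal{S}$, in $O(\mathsf{M}(|\mathcal{S}|)\log|\mathcal{S}|)$ operations. - $\mathsf{TreeVanish}_X(\mathcal{T})$, for a balanced partition tree $\mathcal{T}$ of $\mathcal{S}$, outputs $\big(\prod_{\alpha\in\mathcal{N}}(X-\alpha)\big)_{\mathcal{N}\in\mathcal{T}}$ in $O(\mathsf{M}(|\mathcal{S}|)\log|\mathcal{S}|)$ operations.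 Algorithm $\mathsf{BivariateMPE}(f,\mathcal{P})$, for $f=\sum_{i=0}^{d_Y}f_i(X)Y^i\in\mathbb{F}[X,Y]$: compute $\mathcal{X}=\mathcal{X}(\mathcal{P})$ and $\mathcal{Y}_\alpha=\mathcal{Y}_\alpha(\mathcal{P})$; for $i=0,\dots,d_Y$ compute $\mathcal{F}_i=\mathsf{UnivariateMPE}(f_i,\mathcal{X})$; for each $\alpha\in\mathcal{X}$ form $g_\alpha=\sum_{i=0}^{d_Y}\mathcal{F}_i[\alpha]Y^i$ and compute $\mathcal{G}_\alpha=\mathsf{UnivariateMPE}(g_\alpha,\mathcal{Y}_\alpha)$; return $(\mathcal{G}_\alpha[\beta])_{(\alpha,\beta)\in\mathcal{P}}$. Subroutine $\mathsf{Combine}(\mathcal{S},\mathcal{V},\mathcal{T},\mathcal{U})$, with $\mathcal{V}\in\mathbb{F}[Y]^{\mathcal{S}}$, $\mathcal{S}\ne\emptyset$ a node of the balanced partition tree $\mathcal{T}$, $\mathcal{U}=\mathsf{TreeVanish}_X(\mathcal{T})$: if $\mathcal{S}=\{\alpha\}$ return $\mathcal{V}[\alpha]$; otherwise let $\{\mathcal{S}_1,\mathcal{S}_2\}=\mathcal{T}[\mathcal{S}]$, compute recursively $\hat f_k=\mathsf{Combine}(\mathcal{S}_k,(\mathcal{V}[\alpha])_{\alpha\in\mathcal{S}_k},\mathcal{T},\mathcal{U})$ for $k=1,2$, and return $\hat f_1\,\mathcal{U}[\mathcal{S}_2]+\hat f_2\,\mathcal{U}[\mathcal{S}_1]$. Subroutine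 $\mathsf{BivariateInterp}(\mathcal{P},\mathcal{F})$, for $\mathcal{F}\in\mathbb{F}^{\mathcal{P}}$: let $\mathcal{X}=\mathcal{X}(\mathcal{P})$; for each $\alpha\in\mathcal{X}$ compute $\hat f_\alpha=\mathsf{UnivariateInterp}_Y\big(\mathcal{Y}_\alpha(\mathcal{P}),(\mathcal{F}[\alpha,\beta])_{\beta\in\mathcal{Y}_\alpha(\mathcal{P})}\big)$; let $\mathcal{T}$ be a balanced partition tree of $\mathcal{X}$ and $\mathcal{U}=\mathsf{TreeVanish}_X(\mathcal{T})$; let $h$ be the formal derivative of $\mathcal{U}[\mathcal{X}]$ and $\mathcal{R}=\mathsf{UnivariateMPE}(h,\mathcal{X})$; return $\mathsf{Combine}\big(\mathcal{X},(\hat f_\alpha/\mathcal{R}[\alpha])_{\alpha\in\mathcal{X}},\mathcal{T},\mathcal{U}\big)$. Algorithm $\mathsf{SemiGridUnencode}$. Input: the code with $\mathcal{P}=\{P_1,\dots,P_n\}$ and a codeword $(c_1,\dots,c_n)$. Put $\mathcal{F}[P_i]=c_i$, compute $\hat f=\mathsf{BivariateInterp}(\mathcal{P},\mathcal{F})\in\mathbb{F}[X,Y]$, and return $\hat f(x,y)$. Complexity counts basic arithmetic operations in the field on an algebraic RAM model (table retrieval and insertion cost $O(1)$). $\mathsf{M}(n)$ is the cost of multiplying two univariate polynomials over the field of degree at most $n$; one can take $\mathsf{M}(n)\in O(n\log n\log\log n)\subset\tilde{O}(n)$. Here $\tilde{O}(h)=\bigcup_{c\ge0}O(h\log^c h)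$.
   Formalization: The multiplication cost M is additionally assumed to satisfy M(1) > 0 and M(n)/n nondecreasing (the usual convention); without such a condition the stated bounds can fail. *)

(* Defs.v *)
From HB Require Import structures.
From mathcomp Require Import all_boot all_order all_algebra finmap.
From mathcomp Require Import all_classical all_reals all_analysis.

Set Implicit Arguments.
Unset Strict Implicit.
Unset Printing Implicit Defensive.

Import Order.TTheory GRing.Theory Num.Theory.
Import numFieldNormedType.Exports.

Local Open Scope fset_scope.
Local Open Scope fmap_scope.
Local Open Scope classical_set_scope.
Local Open Scope ring_scope.

(* Complexity classes of functions on an index type [I], with respect to a    *)
(* filter telling which indices are large.                                    *)

Definition class_O (R : realType) (I : Type) (Fil : filter_on I)
    (h : I -> R) : set (I -> R) :=
  [set t : I -> R | (t : I -> R^o) =O_Fil (h : I -> R^o)].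

Definition class_softO (R : realType) (I : Type) (Fil : filter_on I)
    (h : I -> R) : set (I -> R) :=
  \bigcup_(c : nat) class_O Fil (fun i => h i * ln (h i) ^+ c).

(* Programs of the algebraic RAM: a result together with the number of        *)
(* operations spent. A field operation, a table retrieval and a table         *)
(* insertion are charged one unit each.                                       *)

Record prog (A : Type) := Prog { result : A ; cost : nat }.

Definition ret (A : Type) (a : A) : prog A := Prog a 0%N.

Definition ops (A : Type) (k : nat) (a : A) : prog A := Prog a k.

Definition bind (A B : Type) (c : prog A) (k : A -> prog B) : prog B :=
  Prog (result (k (result c))) (cost c + cost (k (result c)))%N.

Notation "'let*' x ':=' c 'in' k" := (bind c (fun x => k))
  (at level 200, x name, c at level 100, k at level 200,
   format "'[v' 'let*'  x  ':='  c  'in' '/' k ']'").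

Fixpoint foldp (A S : Type) (f : S -> A -> prog S) (s : S) (l : seq A) :
    prog S :=
  if l is a :: l' then let* s' := f s a in foldp f s' l' else ret s.

Fixpoint mapp (A B : Type) (f : A -> prog B) (l : seq A) : prog (seq B) :=
  if l is a :: l' then
    let* b := f a in let* bs := mapp f l' in ret (b :: bs)
  else ret [::].

(* Lookup tables are finite maps. The default value [d] is only there to make *)
(* retrieval total.                                                           *)
Definition read (A : choiceType) (B : Type) (d : B) (t : {fmap A -> B})
    (a : A) : prog B :=
  ops 1 (odflt d t.[? a]).

Definition write (A : choiceType) (B : Type) (t : {fmap A -> B}) (a : A)
    (b : B) : prog {fmap A -> B} :=
  ops 1 t.[a <- b].

Definition tabulate (A : choiceType) (B : Type) (f : A -> prog B)
    (l : seq A) : prog {fmap A -> B} :=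
  foldp (fun t a => let* b := f a in write t a b) [fmap] l.

(* Bivariate polynomials: an element of [{poly {poly F}}] is read as          *)
(* \sum_i f_i(X) Y^i, i.e. the outer variable is Y and the inner one is X.    *)

Definition degY (F : finFieldType) (f : {poly {poly F}}) : nat := (size f).-1.

Definition eval2 (F : finFieldType) (f : {poly {poly F}}) (P : F * F) : F :=
  f.[P.2%:P].[P.1].

Definition eval2_ext (F K : fieldType) (iota : {rmorphism F -> K})
    (f : {poly {poly F}}) (x y : K) : K :=
  (map_poly (map_poly iota) f).[y%:P].[x].

Inductive ptree (F : Type) : Type :=
  | Leaf of F
  | Node of ptree F & ptree F.

Section Trees.
Variable F : finFieldType.

Fixpoint label (t : ptree F) : {set F} :=
  match t with
  | Leaf a => [set a]
  | Node l r => label l :|: label r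
  end%SET.

Fixpoint nodes (t : ptree F) : seq {set F} :=
  label t :: match t with
             | Leaf _ => [::]
             | Node l r => nodes l ++ nodes r
             end.

Fixpoint balanced (t : ptree F) : bool :=
  match t with
  | Leaf _ => true
  | Node l r => [&& [disjoint label l & label r],
                    (#|label l| <= #|label r|.+1)%N,
                    (#|label r| <= #|label l|.+1)%N,
                    balanced l & balanced r]
  end.

End Trees.

Section Subroutines.
Variables (R : realType) (M : nat -> nat).

(* Usual conventions on a multiplication time: it is positive, n |-> M(n)/n   *)
(* is nondecreasing, and M is quasi-linear.                                   *)
Definition multiplication_time : Prop :=
  [/\ (0 < M 1)%N,
      forall k n : nat, (0 < k <= n)%N -> (M k * n <= M n * k)%N
    & class_O eventually_filterType (fun n => n%:R * ln n%:R * ln (ln n%:R))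
        (fun n => (M n)%:R : R)].

Definition quasi_multiplication (T : nat -> nat) : Prop :=
  class_O eventually_filterType (fun n => (M n)%:R * ln n%:R) (fun n => (T n)%:R : R).

Definition poly_mul_spec
    (pmul : forall F : finFieldType, {poly F} -> {poly F} -> prog {poly F}) :=
  forall (F : finFieldType) (g h : {poly F}),
    result (pmul F g h) = g * h /\
    forall n : nat, (size g <= n.+1)%N -> (size h <= n.+1)%N ->
      (cost (pmul F g h) <= M n)%N.

Definition univariate_mpe_spec
    (umpe : forall F : finFieldType,
       {poly F} -> {set F} -> prog {fmap F -> F}) :=
  exists2 T : nat -> nat, quasi_multiplication T &
  forall (F : finFieldType) (h : {poly F}) (S : {set F}),
    (forall a : F,
       (result (umpe F h S)).[? a] = if a \in S then Some h.[a] else None) /\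
    (cost (umpe F h S) <= T ((size h).-1 + #|S|))%N.

Definition univariate_interp_spec
    (uinterp : forall F : finFieldType,
       {set F} -> {fmap F -> F} -> prog {poly F}) :=
  exists2 T : nat -> nat, quasi_multiplication T &
  forall (F : finFieldType) (S : {set F}) (V : {fmap F -> F}),
    (forall a : F, (a \in domf V) = (a \in S)) ->
    [/\ (size (result (uinterp F S V)) <= #|S|)%N,
        forall a : F, a \in S -> V.[? a] = Some (result (uinterp F S V)).[a]
      & (cost (uinterp F S V) <= T #|S|)%N].

Definition tree_vanish_spec
    (tvanish : forall F : finFieldType,
       ptree F -> prog {fmap {set F} -> {poly F}}) :=
  exists2 T : nat -> nat, quasi_multiplication T &
  forall (F : finFieldType) (t : ptree F), balanced t ->
    (forall N : {set F},
       (result (tvanish F t)).[? N] =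
         if N \in nodes t then Some (\prod_(a in N) ('X - a%:P)) else None) /\
    (cost (tvanish F t) <= T #|label t|)%N.

Definition partition_tree_spec
    (ptree_of : forall F : finFieldType, {set F} -> ptree F) :=
  forall (F : finFieldType) (S : {set F}), S != finset.set0 ->
    label (ptree_of F S) = S /\ balanced (ptree_of F S).

End Subroutines.

Section Algorithms.
Variables
  (pmul : forall F : finFieldType, {poly F} -> {poly F} -> prog {poly F})
  (umpe : forall F : finFieldType, {poly F} -> {set F} -> prog {fmap F -> F})
  (uinterp : forall F : finFieldType,
     {set F} -> {fmap F -> F} -> prog {poly F})
  (tvanish : forall F : finFieldType,
     ptree F -> prog {fmap {set F} -> {poly F}})
  (ptree_of : forall F : finFieldType, {set F} -> ptree F).

Section Field.
Variable F : finFieldType.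

(* The set of X-coordinates of P, and the table of the sets of Y-coordinates  *)
(* above each of them.                                                        *)
Definition coordinates (P : {set F * F}) :
    prog ({set F} * {fmap F -> {set F}}) :=
  foldp (fun XY p =>
           let* X := ops 1 (p.1 |: XY.1)%SET in
           let* Yp := read finset.set0 XY.2 p.1 in
           let* Yp' := ops 1 (p.2 |: Yp)%SET in
           let* Y := write XY.2 p.1 Yp' in
           ret (X, Y))
        (finset.set0, [fmap]) (enum P).

Definition bivariate_mpe (f : {poly {poly F}}) (P : {set F * F}) :
    prog {fmap F * F -> F} :=
  let* XY := coordinates P in
  let* Fs := tabulate
    (fun i : nat => let* fi := ops 1 f`_i in umpe fi XY.1)
    (iota 0 (degY f).+1) in
  let* G := tabulate
    (fun a =>
       let* cs := mapp (fun i : nat => let* Fi := read [fmap] Fs i in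
                                       read 0 Fi a)
                       (iota 0 (degY f).+1) in
       let* Ya := read finset.set0 XY.2 a in
       umpe (Poly cs) Ya)
    (enum XY.1) in
  tabulate (fun p => let* Ga := read [fmap] G p.1 in read 0 Ga p.2) (enum P).

Definition restrict_table (B : Type) (d : B) (V : {fmap F -> B}) (S : {set F}) :
    prog {fmap F -> B} :=
  tabulate (fun a => read d V a) (enum S).

(* Product of a bivariate polynomial by u(X), coefficient by coefficient in Y *)
Definition mulX (f : {poly {poly F}}) (u : {poly F}) :
    prog {poly {poly F}} :=
  let* cs := mapp (fun c => pmul c u) f in ret (Poly cs).

(* Sum of bivariate polynomials, one operation for each coefficient. *)
Definition add2 (f g : {poly {poly F}}) : prog {poly {poly F}} :=
  ops (\sum_(j < maxn (size f) (size g)) maxn (size (f`_j)%R) (size (g`_j)%R))%N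
      (f + g).

Fixpoint combine (t : ptree F) (V : {fmap F -> {poly F}})
    (U : {fmap {set F} -> {poly F}}) : prog {poly {poly F}} :=
  match t with
  | Leaf a =>
      (* an element of F[Y] is rewritten as one of F[X, Y] *)
      let* v := read 0 V a in ops (size v) (map_poly polyC v)
  | Node t1 t2 =>
      (* retrieval of the two children of the current node *)
      let* S12 := ops 1 (label t1, label t2) in
      let* V1 := restrict_table 0 V S12.1 in
      let* V2 := restrict_table 0 V S12.2 in
      let* f1 := combine t1 V1 U in
      let* f2 := combine t2 V2 U in
      let* u1 := read 0 U S12.1 in
      let* u2 := read 0 U S12.2 in
      let* g1 := mulX f1 u2 in
      let* g2 := mulX f2 u1 in
      add2 g1 g2
  end.

Definition bivariate_interp (P : {set F * F}) (V : {fmap F * F -> F}) :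
    prog {poly {poly F}} :=
  let* XY := coordinates P in
  let* fs := tabulate
    (fun a =>
       let* Ya := read finset.set0 XY.2 a in
       let* Va := tabulate (fun b => read 0 V (a, b)) (enum Ya) in
       uinterp Ya Va)
    (enum XY.1) in
  (* one insertion for each element of each node of the tree *)
  let* t := ops (\sum_(N <- nodes (ptree_of XY.1)) #|N|)%N (ptree_of XY.1) in
  let* U := tvanish t in
  let* UX := read 0 U XY.1 in
  (* the coefficients i * u_i take at most two operations each *)
  let* h := ops (2 * size UX)%N UX^`() in
  let* Rs := umpe h XY.1 in
  let* W := tabulate
    (fun a =>
       let* fa := read 0 fs a in
       let* r := read 0 Rs a in
       let* ri := ops 1 r^-1 in
       ops (size fa) (ri *: fa))
    (enum XY.1) in
  combine t W U.

End Field.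

(* The algorithm returns the element f(x, y) of the function field; it is     *)
(* represented by its standard form, hence the last step is free of charge.   *)
Definition semi_grid_unencode (F : finFieldType) (K : fieldType)
    (iota : {rmorphism F -> K}) (x y : K) (n : nat) (P : n.-tuple (F * F))
    (c : 'rV[F]_n) : prog K :=
  let* V := foldp (fun V i => let* ci := ops 1 (c 0 i) in
                              write V (tnth P i) ci)
                  [fmap] (enum 'I_n) in
  let* f := bivariate_interp [set p in P]%SET V in
  ret (eval2_ext iota f x y).

End Algorithms.

Section Hermitian.
Variables (F : finFieldType) (q : nat).

Definition hermitian_poly : {poly {poly F}} :=
  'X^q + 'X - 'X^(q.+1)%:P.

Definition hermitian_points : {set F * F} :=
  [set P | eval2 hermitian_poly P == 0]%SET.

End Hermitian.

Section FunctionField.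
Variables (F K : fieldType) (iota : {rmorphism F -> K}).

(* Places of K/F, given by their valuation rings. *)
Definition is_place (O : set K) : Prop :=
  [/\ forall a : F, O (iota a),
      forall u v : K, O u -> O v -> O (u - v) /\ O (u * v),
      forall z : K, O z \/ O z^-1
    & exists z : K, ~ O z].

Definition max_ideal (O : set K) : set K :=
  [set z | O z /\ (z != 0 -> ~ O z^-1)].

Definition uniformizer (O : set K) (t : K) : Prop :=
  [/\ t != 0, max_ideal O t & forall z, max_ideal O z -> O (z / t)].

(* The Riemann-Roch space L(m P): z = 0, or z has no pole outside P and       *)
(* v_P(z) >= - m.                                                             *)
Definition riemann_roch (P : set K) (m : nat) : set K :=
  [set z | (forall O : set K, is_place O -> O <> P -> O z) /\
           exists2 t : K, uniformizer P t & P (t ^+ m * z)].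

(* K is the function field F(x, y) of the plane curve H = 0: x is             *)
(* transcendental over F, H(x, y) = 0, and x and y generate K over F.         *)
Definition function_field_of (H : {poly {poly F}}) (x y : K) : Prop :=
  [/\ forall p : {poly F}, p != 0 -> (map_poly iota p).[x] != 0,
      eval2_ext iota H x y = 0
    & forall z : K, exists g h : {poly {poly F}},
        eval2_ext iota h x y != 0 /\
        z = eval2_ext iota g x y / eval2_ext iota h x y].

End FunctionField.

(* The data defining a Hermitian code. The place P_oo is determined by the    *)
(* fact that it is a pole of x.                                               *)
Record hermitian_code := HermitianCode {
  hq : nat;
  hF : finFieldType;
  hK : fieldType;
  hiota : {rmorphism hF -> hK};
  hx : hK;
  hy : hK;
  hPoo : set hK;
  hm : nat;
  hn : nat;
  hP : hn.-tuple (hF * hF);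
  hq_prime_power : exists p k : nat, [/\ prime p, (0 < k)%N & hq = (p ^ k)%N];
  hF_card : #|hF| = (hq ^ 2)%N;
  h_function_field : function_field_of hiota (hermitian_poly hF hq) hx hy;
  hPoo_place : is_place hiota hPoo;
  hPoo_pole : ~ hPoo hx;
  hP_uniq : uniq hP;
  hP_points : forall P : hF * hF, (P \in hP) = (P \in hermitian_points hF hq);
  hm_lt_hn : (hm < hn)%N
}.

Arguments hiota : clear implicits.
Arguments hx : clear implicits.
Arguments hy : clear implicits.
Arguments hPoo : clear implicits.
Arguments hP : clear implicits.

(* Polynomials in standard form (y-degree less than deg_Y H = q) that lie in  *)
(* L(m P_oo).                                                                 *)
Definition message (C : hermitian_code) (f : {poly {poly hF C}}) : Prop :=
  (size f <= hq C)%N /\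
  riemann_roch (hiota C) (hPoo C) (hm C)
    (eval2_ext (hiota C) f (hx C) (hy C)).

Definition encoding (C : hermitian_code) (f : {poly {poly hF C}}) :
    'rV[hF C]_(hn C) :=
  \row_i eval2 f (tnth (hP C) i).

Definition codeword (C : hermitian_code) (c : 'rV[hF C]_(hn C)) : Prop :=
  exists2 f, message f & c = encoding f.

(* Complexities are functions of (q, m, n), where (q, m, n) ranges over the   *)
(* parameters of Hermitian codes and the length n tends to infinity.          *)
Record code_params := CodeParams { pq : nat; pm : nat; pn : nat }.

Definition params (C : hermitian_code) : code_params :=
  CodeParams (hq C) (hm C) (hn C).

Definition n_large : set_system code_params :=
  filter_from setT (fun N : nat =>
    [set p | (N <= pn p)%N /\ exists C : hermitian_code, params C = p]).

Global Instance n_large_filter : Filter n_large.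
Proof.
apply: filter_from_filter; first by exists 0%N.
move=> i j _ _; exists (maxn i j) => // p [].
by rewrite geq_max => /andP[].
Qed.

Definition n_oo : filter_on code_params := FilterType n_large n_large_filter.

(* Main.v *)
Require Import Defs.
From HB Require Import structures.
From mathcomp Require Import all_boot all_order all_algebra finmap.
From mathcomp Require Import all_classical all_reals all_analysis.
From mathcomp Require Import finfield.
From mathcomp Require Import zify ring lra.

Set Implicit Arguments.
Unset Strict Implicit.
Unset Printing Implicit Defensive.

Import Order.TTheory GRing.Theory Num.Theory.
Import numFieldNormedType.Exports.

Local Open Scope fmap_scope.
Local Open Scope ring_scope.

(** Two facts about a Hermitian code carry the proof: the points form a grid
    with equal columns, and a message has small degrees.

    The points. The map b |-> b^q + b is additive, takes values in the fixed
    field of the q-power Frobenius, and is a polynomial of degree q. Each of its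
    fibres has at most q elements, the fixed field has at most q elements, and
    the fibres over the fixed field cover all q^2 elements of the field; hence
    each of them has exactly q elements. As a^(q+1) is fixed by Frobenius, there
    are q points above every abscissa ([card_hermitian_fibre]), q^2 abscissas
    and n = q^3 points.

    The degrees. Put u = y/x. The curve equation shows that, up to units at the
    pole of x, x is u^q and y is u^(q+1). The monomials x^i y^j with j < q
    therefore have pairwise distinct orders, so that no cancellation of poles
    can occur: if f lies in L(m P_oo), every monomial of f satisfies
    q i + (q+1) j <= m ([pole_order_bound]). Only the order of K* modulo the
    units of the place is used, never a valuation with integer values. It
    follows that q deg f_j <= m < q^3, so each f_j has degree less than q^2.

    Encoding. Evaluation is correct by substituting first in X, then in Y. Its
    cost is that of q evaluations of total size q (m/q + q^2) <= m + n, and of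
    q^2 evaluations of size 2 q, of total size 2 n. Since M(k)/k is
    nondecreasing, the costs of subproblems add up to at most a constant times
    the cost of one problem of the total size ([mul_time_scale]).

    Unencoding. By the degree bounds, a message is determined by its values on
    the grid. Interpolating along the columns yields f(a, Y) for each abscissa
    a, and the recursive combination computes the Lagrange formula in X applied
    to all coefficients in Y at once; the weights are the inverses of the values
    of the derivative of the polynomial vanishing at the abscissas
    ([result_combine], [lagrange_evalX]). A tree node with s leaves costs
    O(q M(s)), at most s/q^2 times O(q M(q^2)); as the tree is balanced, the
    sizes of its nodes add up to q^2 O(log q) ([tree_size_le]). The single
    evaluation of size 2 q^2 at the derivative is not bounded by M(q^2) through
    monotonicity of M(k)/k; there the quasi-linear upper bound on M gives
    O(q^2 log^3 q), hence O(q^3). *)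

(** * Loops that fill tables *)

Section Programs.
Local Open Scope nat_scope.

(** Keys may repeat in [l]: the table stays well defined because the stored
    value depends on the key alone. *)
Lemma result_fill (A : choiceType) (B : Type) (I : eqType) (key : I -> A)
    (val : A -> B) (f : I -> prog B) (t : {fmap A -> B}) (l : seq I) (a : A) :
  (forall i, i \in l -> result (f i) = val (key i)) ->
  (result (foldp (fun t i => let* b := f i in write t (key i) b) t l)).[? a] =
  if a \in map key l then Some (val a) else t.[? a].
Proof.
elim: l t => [//|i l IHl] t fE /=; rewrite IHl; last first.
  by move=> j jl; rewrite fE// inE jl orbT.
rewrite fnd_set inE fE ?mem_head//; case: ifP => [_|_]; first by rewrite orbT.
by rewrite orbF; case: eqP => [->|].
Qed.

Lemma cost_fill (A : choiceType) (B : Type) (I : Type) (key : I -> A)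
    (f : I -> prog B) (t : {fmap A -> B}) (l : seq I) :
  cost (foldp (fun t i => let* b := f i in write t (key i) b) t l) =
  \sum_(i <- l) (cost (f i)).+1.
Proof.
elim: l t => [|i l IHl] t /=; first by rewrite big_nil.
by rewrite IHl big_cons addn1.
Qed.

Lemma result_tabulate (A : choiceType) (B : Type) (f : A -> prog B)
    (l : seq A) (a : A) :
  (result (tabulate f l)).[? a] =
  if a \in l then Some (result (f a)) else None.
Proof.
by rewrite (@result_fill _ _ _ id (fun a => result (f a))) ?map_id ?fnd_fmap0.
Qed.

Lemma cost_tabulate (A : choiceType) (B : Type) (f : A -> prog B) (l : seq A) :
  cost (tabulate f l) = \sum_(a <- l) (cost (f a)).+1.
Proof. exact: (@cost_fill _ _ _ id). Qed.

Lemma result_mapp (A B : Type) (f : A -> prog B) (l : seq A) :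
  result (mapp f l) = [seq result (f a) | a <- l].
Proof. by elim: l => //= a l ->. Qed.

Lemma cost_mapp (A B : Type) (f : A -> prog B) (l : seq A) :
  cost (mapp f l) = \sum_(a <- l) cost (f a).
Proof.
elim: l => [|a l IHl] /=; first by rewrite big_nil.
by rewrite IHl big_cons addn0.
Qed.

Lemma sum_enum_le (T : finType) (A : {set T}) (g : T -> nat) (c : nat) :
  (forall a, a \in A -> g a <= c) -> \sum_(a <- enum A) g a <= #|A| * c.
Proof.
by move=> gc; rewrite big_enum -sum_nat_const /=; apply: leq_sum.
Qed.

End Programs.

Section Coordinates.
Variable F : finFieldType.
Implicit Types P : {set F * F}.
Local Open Scope nat_scope.

Definition abscissas P : {set F} := [set p.1 | p in P]%SET.

Definition fibre P (a : F) : {set F} := [set b | (a, b) \in P]%SET.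

Lemma mem_abscissas P p : p \in P -> p.1 \in abscissas P.
Proof. exact: imset_f. Qed.

(** The induction over the list of points starts from arbitrary tables, so that
    it also describes the state in the middle of the loop. *)
Lemma coordinates_spec P :
  [/\ (result (coordinates P)).1 = abscissas P,
      forall a, a \in abscissas P ->
        (result (coordinates P)).2.[? a] = Some (fibre P a)
    & cost (coordinates P) = 4 * #|P|].
Proof.
rewrite /coordinates; set step := (fun XY p => _).
have main l X Y : let c := foldp step (X, Y) l in
  [/\ (result c).1 = ([set a | a \in map fst l] :|: X)%SET,
      forall a, (result c).2.[? a] = if a \in map fst l then
        Some ([set b | (a, b) \in l] :|: odflt finset.set0 Y.[? a])%SET
        else Y.[? a]
    & cost c = 4 * size l].
  elim: l X Y => [|[p1 p2] l IHl] X Y /=.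
    by split=> //; apply/setP => a; rewrite !inE.
  have [-> YE ->] := IHl (p1 |: X)%SET
    (Y.[p1 <- (p2 |: odflt finset.set0 Y.[? p1])%SET]).
  split; last by rewrite !addn0 /=; lia.
    by apply/setP => a; rewrite !inE orbCA orbA.
  move=> a; rewrite YE inE fnd_set; case: (eqVneq a p1) => [->|ap] /=.
    case: ifP => pl.
      congr Some; apply/setP => b; rewrite !inE xpair_eqE eqxx /=.
      by rewrite orbCA orbA.
    congr Some; apply/setP => b; rewrite !inE xpair_eqE eqxx /=.
    suff /negPf-> : (p1, b) \notin l by rewrite orbF.
    by apply: contraFN pl => pl; apply/mapP; exists (p1, b).
  case: ifP => // _; congr Some; apply/setP => b.
  by rewrite !inE xpair_eqE (negPf ap).
have [XE YE ->] := main (enum P) finset.set0 [fmap].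
have XP a : (a \in map fst (enum P)) = (a \in abscissas P).
  apply/mapP/imsetP => -[p pP ->]; exists p => //.
    by rewrite -mem_enum.
  by rewrite mem_enum.
split; last by rewrite -cardE.
  by rewrite XE; apply/setP => a; rewrite !inE XP orbF.
move=> a aX; rewrite YE XP aX fnd_fmap0 /=; congr Some.
by apply/setP => b; rewrite !inE mem_enum orbF.
Qed.

End Coordinates.

(** * Evaluation on a set of points *)

Section Evaluation.
Variable F : finFieldType.
Local Open Scope ring_scope.
Implicit Types (P : {set F * F}) (f : {poly {poly F}}) (S : {set F}).

Definition evalX f (a : F) : {poly F} := map_poly (horner^~ a) f.

Lemma coef_evalX f a j : (evalX f a)`_j = (f`_j).[a].
Proof. exact: (coef_map (horner_eval a)). Qed.

Lemma size_evalX f a : (size (evalX f a) <= size f)%N.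
Proof. exact: size_poly. Qed.

Lemma eval2E f (p : F * F) : eval2 f p = (evalX f p.1).[p.2].
Proof.
by rewrite /eval2 -[_.[p.1]]/(horner_eval p.1 _) -horner_map /= /horner_eval hornerC.
Qed.

(** The list has [(degY f).+1] entries even when f is 0; [Poly] drops the
    trailing zero. *)
Lemma evalX_Poly f a :
  Poly [seq (f`_i).[a] | i <- iota 0 (degY f).+1] = evalX f a.
Proof.
apply/polyP => i; rewrite coef_Poly coef_evalX.
have [id|di] := ltnP i (degY f).+1.
  by rewrite (nth_map 0%N) ?size_iota// nth_iota.
rewrite !nth_default ?size_map ?size_iota ?size_poly0 ?horner0//.
all: by move: di; rewrite /degY; case: (size f).
Qed.

Variable umpe : forall F : finFieldType, {poly F} -> {set F} -> prog {fmap F -> F}.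

Lemma bivariate_mpe_correct f P :
  (forall (h : {poly F}) S a,
     (result (umpe h S)).[? a] = if a \in S then Some h.[a] else None) ->
  forall p, p \in P -> (result (bivariate_mpe umpe f P)).[? p] = Some (eval2 f p).
Proof.
move=> umpeE [a b] abP.
have [XE YE _] := coordinates_spec P.
have aX := mem_abscissas abP.
have := evalX_Poly f a; rewrite /bivariate_mpe; move: (degY f).+1 => d fE.
rewrite /= result_tabulate mem_enum abP /=; congr Some.
rewrite result_tabulate XE mem_enum aX /= YE//= umpeE inE abP /= eval2E /=.
rewrite -fE result_mapp; congr ((Poly _).[_]).
apply/eq_in_map => i; rewrite /= result_tabulate => -> /=.
by rewrite umpeE aX.
Qed.

(** The factor 7 counts the four operations per point that group the points by
    abscissa and the three that build the answer. [k1] bounds the sizes of the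
    evaluations in X, and [k2] those of the evaluations in Y. *)
Lemma cost_bivariate_mpe f P (T : nat -> nat) (d k1 k2 : nat) :
  {homo T : i j / (i <= j)%N} ->
  (forall (h : {poly F}) S, (cost (umpe h S) <= T ((size h).-1 + #|S|))%N) ->
  (0 < d)%N -> (size f <= d)%N ->
  (forall i, (size (f`_i)%R).-1 + #|abscissas P| <= k1)%N ->
  (forall a, d.-1 + #|fibre P a| <= k2)%N ->
  (cost (bivariate_mpe umpe f P) <=
     7 * #|P| + d * (T k1 + 2) + #|abscissas P| * (2 * d + 2 + T k2))%N.
Proof.
move=> T_homo umpe_cost d0 fd fk1 fk2.
have dY : ((degY f).+1 <= d)%N by rewrite /degY; lia.
have [XE YE cE] := coordinates_spec P.
rewrite /bivariate_mpe; move: (degY f).+1 dY => d1 dY; rewrite /= cE XE !cost_tabulate /=.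
have c1 : (\sum_(i <- iota 0 d1) (1 + cost (umpe (f`_i)%R (abscissas P))).+1
    <= d * (T k1 + 2))%N.
  apply: (@leq_trans (\sum_(i <- iota 0 d1) (T k1 + 2))).
    apply: leq_sum => i _.
    have := umpe_cost (f`_i)%R (abscissas P); have := T_homo _ _ (fk1 i); lia.
  by rewrite big_const_seq count_predT size_iota iter_addn_0 mulnC leq_mul2r dY orbT.
apply: (@leq_trans (4 * #|P| + (d * (T k1 + 2) +
    (#|abscissas P| * (2 * d + 2 + T k2) + 3 * #|P|)))%N); last first.
  by move: (d * _)%N (#|abscissas P| * _)%N => A B; move: (#|P|)%N => n; lia.
rewrite leq_add2l !leq_add//; last first.
  by rewrite big_const_seq count_predT -cardE iter_addn_0.
apply: sum_enum_le => a aX; rewrite YE//= cost_mapp /=.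
set g := Poly _.
have gd : (size g <= d)%N.
  by rewrite (leq_trans (size_Poly _))// result_mapp size_map size_iota.
have := umpe_cost g (fibre P a).
have : (T ((size g).-1 + #|fibre P a|) <= T k2)%N.
  by apply: T_homo; apply: leq_trans (fk2 a); lia.
rewrite big_const_seq count_predT size_iota iter_addn_0 addn1.
lia.
Qed.

End Evaluation.

(** * Lagrange interpolation along a partition tree *)

Lemma big_setU_disjoint (V : Type) (idx : V) (op : Monoid.com_law idx)
    (T : finType) (A B : {set T}) (G : T -> V) : [disjoint A & B] ->
  \big[op/idx]_(a in (A :|: B)%SET) G a =
  op (\big[op/idx]_(a in A) G a) (\big[op/idx]_(a in B) G a).
Proof. by move=> dis; rewrite -bigU//; apply: eq_bigl => a; rewrite !inE. Qed.

Lemma card_roots_le (F : finFieldType) (g : {poly F}) (S : {set F}) :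
  g != 0 -> (forall a, a \in S -> root g a) -> (#|S| < size g)%N.
Proof.
move=> g0 Sg; rewrite cardE; apply: max_poly_roots g0 _ (enum_uniq _).
by apply/allP => a; rewrite mem_enum; apply: Sg.
Qed.

(** A nonzero difference would have more roots than its degree allows. *)
Lemma poly_eq_on (F : finFieldType) (S : {set F}) (g h : {poly F}) :
  (size g <= #|S|)%N -> (size h <= #|S|)%N ->
  (forall a, a \in S -> g.[a] = h.[a]) -> g = h.
Proof.
move=> gS hS gh; apply/eqP; rewrite -subr_eq0; apply/negPn/negP => d0.
have : (size (g - h)%R <= #|S|)%N.
  by rewrite (leq_trans (size_polyD _ _))// size_polyN geq_max gS.
rewrite leqNgt card_roots_le// => a aS.
by rewrite rootE hornerD hornerN gh// subrr.
Qed.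

Section Lagrange.
Variable F : finFieldType.
Implicit Types (S : {set F}) (v : F -> {poly F}).
Local Open Scope ring_scope.

Definition vanishing S : {poly F} := \prod_(a in S) ('X - a%:P).

Lemma size_vanishing S : size (vanishing S) = #|S|.+1.
Proof. by rewrite /vanishing -big_enum size_prod_XsubC -cardE. Qed.

(** The sum of the v_a(Y) times the product of the X - b for b in S other than
    a: the Lagrange formula with the weights already moved into v. *)
Definition lagrange S v : {poly {poly F}} :=
  \sum_(a in S) map_poly polyC (v a) * (vanishing (S :\ a))%:P.

Lemma coef_lagrange S v j :
  (lagrange S v)`_j = \sum_(a in S) (v a)`_j *: vanishing (S :\ a).
Proof.
rewrite coef_sum; apply: eq_bigr => a _.
by rewrite coefMC coef_map /= mul_polyC.
Qed.

Lemma size_lagrange S v (d : nat) :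
  (forall a, a \in S -> size (v a) <= d)%N -> (size (lagrange S v) <= d)%N.
Proof.
move=> vd; apply: (leq_trans (size_sum _ _ _)); apply/bigmax_leqP => a aS.
apply: leq_trans (vd a aS); rewrite mulrC mul_polyC.
by rewrite (leq_trans (size_scale_leq _ _))// size_poly.
Qed.

Lemma size_coef_lagrange S v j : (size ((lagrange S v)`_j)%R <= #|S|)%N.
Proof.
rewrite coef_lagrange (leq_trans (size_sum _ _ _))//; apply/bigmax_leqP => a aS.
by rewrite (leq_trans (size_scale_leq _ _))// size_vanishing (cardsD1 a S) aS.
Qed.

Lemma vanishingU S1 S2 : [disjoint S1 & S2] ->
  vanishing (S1 :|: S2)%SET = vanishing S1 * vanishing S2.
Proof. by move=> dis; rewrite /vanishing big_setU_disjoint//. Qed.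

(** The recursion of the combination step: enlarging S by a disjoint set
    multiplies each product by the vanishing polynomial of that set. *)
Lemma lagrangeU S1 S2 v : [disjoint S1 & S2] ->
  lagrange (S1 :|: S2)%SET v =
  lagrange S1 v * (vanishing S2)%:P + lagrange S2 v * (vanishing S1)%:P.
Proof.
move=> dis; rewrite /lagrange big_setU_disjoint// /= !mulr_suml.
have aux (A B : {set F}) a : [disjoint A & B] -> a \in A ->
    vanishing ((A :|: B) :\ a) = vanishing (A :\ a)%SET * vanishing B.
  move=> AB aA; have aB : a \notin B by rewrite (disjointFr AB aA).
  rewrite finset.setDUl (_ : (B :\ a = B)%SET); last first.
    by apply/finset.setDidPl; rewrite disjoint_sym disjoints1.
  by rewrite vanishingU// (disjointWl _ AB)// subsetDl.
congr (_ + _); apply: eq_bigr => a aS; first by rewrite aux// polyCM mulrA.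
by rewrite finset.setUC aux 1?disjoint_sym// polyCM mulrA.
Qed.

Lemma horner_vanishingD1 S a b : b \in S -> b != a ->
  (vanishing (S :\ a)).[b] = 0.
Proof.
move=> bS ba; rewrite /vanishing (bigD1 b) ?in_setD1 ?ba//=.
by rewrite hornerM hornerXsubC subrr mul0r.
Qed.

Lemma horner_vanishingD1_neq0 S a : (vanishing (S :\ a)).[a] != 0.
Proof.
rewrite horner_prod; apply/prodf_neq0 => b; rewrite in_setD1 => /andP[ba _].
by rewrite hornerXsubC subr_eq0 eq_sym.
Qed.

(** In the derivative of a product of linear factors, all terms but one vanish
    at a root. *)
Lemma deriv_vanishing S a : a \in S ->
  (vanishing S)^`().[a] = (vanishing (S :\ a)).[a].
Proof.
move=> aS; rewrite {1}/vanishing (big_setD1 a)//= -/(vanishing _) derivM.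
by rewrite derivXsubC mul1r hornerD hornerM hornerXsubC subrr mul0r addr0.
Qed.

(** Coefficient by coefficient in Y, both sides are polynomials in X of degree
    less than the number of points, with the same values at these points. *)
Lemma lagrange_evalX (f : {poly {poly F}}) S :
  (forall j, size (f`_j)%R <= #|S|)%N ->
  lagrange S (fun a => ((vanishing S)^`().[a])^-1 *: evalX f a) = f.
Proof.
move=> fS; apply/polyP => j; apply: (@poly_eq_on _ S) => [||b bS].
- exact: size_coef_lagrange.
- exact: fS.
rewrite coef_lagrange horner_sum (bigD1 b)//= big1 => [|a /andP[aS ab]]; last first.
  by rewrite hornerZ horner_vanishingD1 ?mulr0// eq_sym.
rewrite addr0 hornerZ coefZ deriv_vanishing// coef_evalX mulrAC mulVf ?mul1r//.
exact: horner_vanishingD1_neq0.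
Qed.

End Lagrange.

Section Combine.
Variable F : finFieldType.
Local Open Scope nat_scope.
Variable pmul : forall F : finFieldType, {poly F} -> {poly F} -> prog {poly F}.

(** The total number of elements in all nodes, to which the work done along the
    tree is proportional. *)
Definition tree_size (t : ptree F) : nat := \sum_(N <- nodes t) #|N|.

(** The nodes of one level are disjoint, and balance halves the sizes from one
    level to the next, rounding up: there are at most d + 1 levels. *)
Lemma tree_size_leaf a : tree_size (Leaf a) = 1.
Proof. by rewrite /tree_size /= big_cons big_nil cards1. Qed.

Lemma tree_size_node l r :
  tree_size (Node l r) = #|label (Node l r)| + tree_size l + tree_size r.
Proof. by rewrite /tree_size [nodes _]/= big_cons big_cat addnA. Qed.

Lemma card_label_gt0 (t : ptree F) : 0 < #|label t|.
Proof.
elim: t => [a|l IHl r _] /=; first by rewrite cards1.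
by apply: leq_trans IHl _; rewrite subset_leq_card// finset.subsetUl.
Qed.

Lemma card_label_node (l r : ptree F) : balanced (Node l r) ->
  #|label (Node l r)| = #|label l| + #|label r|.
Proof.
move=> /= /and5P[dis _ _ _ _]; rewrite cardsU.
by move: dis; rewrite -finset.setI_eq0 => /eqP->; rewrite cards0 subn0.
Qed.

Lemma tree_size_le (t : ptree F) (d : nat) :
  balanced t -> #|label t| <= 2 ^ d -> tree_size t <= #|label t| * d.+1.
Proof.
elim: t d => [a|l IHl r IHr] d bt; first by rewrite tree_size_leaf /= cards1.
rewrite tree_size_node (card_label_node bt) => sd.
move: bt => /= /and5P[_ lr rl bl br].
have := card_label_gt0 l; have := card_label_gt0 r.
have := IHl d.-1 bl; have := IHr d.-1 br; move: lr rl sd.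
move: (#|label l|) (#|label r|) (tree_size l) (tree_size r) => a b A B.
case: d => [|d]; first by rewrite expn0; lia.
rewrite expnS /=; move: (2 ^ d) => p ab ba sd HB HA b0 a0.
have {}HB : B <= b * d.+1 by apply: HB; lia.
have {}HA : A <= a * d.+1 by apply: HA; lia.
by rewrite mulnDl [a * _]mulnS [b * _]mulnS; lia.
Qed.

Lemma label_nodes (t : ptree F) : label t \in nodes t.
Proof. by case: t => [a|l r] /=; rewrite mem_head. Qed.

Lemma result_restrict_table (B : Type) (dflt : B) (V : {fmap F -> B})
    (v : F -> B) (S : {set F}) a :
  (forall b, b \in S -> V.[? b] = Some (v b)) -> a \in S ->
  (result (restrict_table dflt V S)).[? a] = Some (v a).
Proof. by move=> VE aS; rewrite result_tabulate mem_enum aS /= VE. Qed.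

Lemma cost_restrict_table (B : Type) (dflt : B) (V : {fmap F -> B}) (S : {set F}) :
  cost (restrict_table dflt V S) = 2 * #|S|.
Proof. by rewrite cost_tabulate /= big_const_seq count_predT -cardE iter_addn_0. Qed.

Hypothesis pmulE : forall g h : {poly F}, result (pmul g h) = (g * h)%R.

Lemma result_mulX (f : {poly {poly F}}) (u : {poly F}) :
  result (mulX pmul f u) = (f * u%:P)%R.
Proof.
rewrite /mulX /= result_mapp; apply/polyP => j.
rewrite coef_Poly coefMC; have [jf|fj] := ltnP j (size f).
  by rewrite (nth_map 0%R).
by rewrite !nth_default ?size_map// mul0r.
Qed.

Lemma result_combine_node (l r : ptree F) (V : {fmap F -> {poly F}})
    (U : {fmap {set F} -> {poly F}}) :
  result (combine pmul (Node l r) V U) =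
  (result (combine pmul l (result (restrict_table 0%R V (label l))) U) *
     (odflt 0 U.[? label r])%:P +
   result (combine pmul r (result (restrict_table 0%R V (label r))) U) *
     (odflt 0 U.[? label l])%:P)%R.
Proof. by rewrite -!result_mulX. Qed.

(** Induction on the tree: at a leaf {a} the product over the other points is
    empty, and at a node the step is [lagrangeU]. *)
Lemma result_combine (t : ptree F) (V : {fmap F -> {poly F}})
    (U : {fmap {set F} -> {poly F}}) (v : F -> {poly F}) :
  balanced t ->
  (forall a, a \in label t -> V.[? a] = Some (v a)) ->
  (forall N, N \in nodes t -> U.[? N] = Some (vanishing N)) ->
  result (combine pmul t V U) = lagrange (label t) v.
Proof.
elim: t V => [a|l IHl r IHr] V bt VE UE.
  rewrite /= VE ?inE//= /lagrange big_set1 finset.setDv.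
  by rewrite /vanishing big_set0 mulr1.
rewrite result_combine_node; move: (bt) => /= /and5P[dis _ _ bl br].
rewrite lagrangeU// (IHl _ bl); first last.
- by move=> N Nl; rewrite UE//= inE mem_cat Nl orbT.
- move=> a al; apply: result_restrict_table => // b bl'.
  by rewrite VE//= inE bl'.
rewrite (IHr _ br); first last.
- by move=> N Nr; rewrite UE//= inE mem_cat Nr !orbT.
- move=> a ar; apply: result_restrict_table => // b br'.
  by rewrite VE//= inE br' orbT.
by rewrite !UE//= inE mem_cat label_nodes ?orbT.
Qed.

Variable M : nat -> nat.
Hypothesis M_superlinear :
  forall k n : nat, 0 < k <= n -> M k * n <= M n * k.
Hypothesis M_ge : forall n : nat, 0 < n -> n <= M n.
Hypothesis pmul_cost : forall (g h : {poly F}) n,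
  size g <= n.+1 -> size h <= n.+1 -> cost (pmul g h) <= M n.

Lemma cost_mulX (f : {poly {poly F}}) (u : {poly F}) (d n : nat) :
  size f <= d -> (forall j, size (f`_j)%R <= n.+1) -> size u <= n.+1 ->
  cost (mulX pmul f u) <= d * M n.
Proof.
move=> fd fn un; rewrite /mulX /= cost_mapp addn0.
apply: (@leq_trans (\sum_(c <- f) M n)).
  rewrite !big_seq; apply: leq_sum => c /(nthP 0%R)[j _ <-].
  exact: pmul_cost.
by rewrite big_const_seq count_predT iter_addn_0 mulnC leq_mul2r fd orbT.
Qed.

Lemma cost_add2 (f g : {poly {poly F}}) (d n : nat) :
  size f <= d -> size g <= d ->
  (forall j, size (f`_j)%R <= n) -> (forall j, size (g`_j)%R <= n) ->
  cost (add2 f g) <= d * n.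
Proof.
move=> fd gd fn gn; apply: (@leq_trans (\sum_(j < maxn (size f) (size g)) n)).
  by apply: leq_sum => j _; rewrite geq_max fn gn.
by rewrite sum_nat_const card_ord leq_mul2r geq_max fd gd orbT.
Qed.

(** The work at a node with s elements is O(d M(s)), and M(s) / s <= M(n) / n.
    So it is at most 8 d M(n) s / n, which sums to a multiple of the tree size.
    The factor n is kept on the left to avoid division. *)
Lemma cost_combine (t : ptree F) (V : {fmap F -> {poly F}})
    (U : {fmap {set F} -> {poly F}}) (v : F -> {poly F}) (d n : nat) :
  balanced t -> 0 < d -> #|label t| <= n ->
  (forall a, a \in label t -> V.[? a] = Some (v a)) ->
  (forall a, a \in label t -> size (v a) <= d) ->
  (forall N, N \in nodes t -> U.[? N] = Some (vanishing N)) ->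
  cost (combine pmul t V U) * n <= 8 * d * M n * tree_size t.
Proof.
move=> + d0; elim: t V => [a|l IHl r IHr] V bt tn VE vd UE.
  rewrite tree_size_leaf /= VE ?inE//= muln1.
  have va : size (v a) <= d by rewrite vd ?inE.
  have n0 : 0 < n by move: tn; rewrite /= cards1.
  rewrite leq_mul ?M_ge// (leq_trans (leq_add d0 va))//.
  by rewrite addnn -mul2n leq_mul2r orbT.
have [bl br] : balanced l /\ balanced r by case/and5P: bt.
set s := #|label (Node l r)|.
have sE : s = #|label l| + #|label r| := card_label_node bt.
have l0 := card_label_gt0 l; have r0 := card_label_gt0 r.
have [UEl UEr] : (forall N, N \in nodes l -> U.[? N] = Some (vanishing N)) /\
    (forall N, N \in nodes r -> U.[? N] = Some (vanishing N)).
  by split=> N Nt; apply: UE; rewrite /= inE mem_cat Nt ?orbT.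
set V1 := result (restrict_table 0%R V (label l)).
set V2 := result (restrict_table 0%R V (label r)).
have V1E a : a \in label l -> V1.[? a] = Some (v a).
  move=> al; apply: result_restrict_table => // b bl'.
  by rewrite VE//= inE bl'.
have V2E a : a \in label r -> V2.[? a] = Some (v a).
  move=> ar; apply: result_restrict_table => // b br'.
  by rewrite VE//= inE br' orbT.
have vdl a : a \in label l -> size (v a) <= d by move=> al; rewrite vd//= inE al.
have vdr a : a \in label r -> size (v a) <= d by move=> ar; rewrite vd//= inE ar orbT.
have nE : #|label (Node l r)| <= n := tn.
rewrite -/s sE in nE.
have := IHl V1 bl _ V1E vdl UEl; have := IHr V2 br _ V2E vdr UEr.
move=> /(_ ltac:(lia)) cr /(_ ltac:(lia)) cl.
have rl := result_combine bl V1E UEl; have rr := result_combine br V2E UEr.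
set f1 := lagrange _ v in rl; set f2 := lagrange _ v in rr.
pose g1 := result (mulX pmul f1 (vanishing (label r))).
pose g2 := result (mulX pmul f2 (vanishing (label l))).
(* The ten summands are the successive instructions at an inner node. *)
have -> : cost (combine pmul (Node l r) V U) =
  1 + (2 * #|label l| + (2 * #|label r| + (cost (combine pmul l V1 U) +
  (cost (combine pmul r V2 U) + (1 + (1 + (cost (mulX pmul f1 (vanishing (label r))) +
  (cost (mulX pmul f2 (vanishing (label l))) + cost (add2 g1 g2))))))))).
  rewrite -(cost_restrict_table 0%R V) -(cost_restrict_table 0%R V (label r)).
  rewrite /g1 /g2 -rl -rr.
  have -> : vanishing (label l) = odflt 0%R U.[? label l] by rewrite UEl// label_nodes.
  have -> : vanishing (label r) = odflt 0%R U.[? label r] by rewrite UEr// label_nodes.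
  by [].
have f1d : size f1 <= d by exact: size_lagrange.
have f2d : size f2 <= d by exact: size_lagrange.
have f1s j : size (f1`_j)%R <= s.+1.
  by rewrite (leq_trans (size_coef_lagrange _ _ _))//; lia.
have f2s j : size (f2`_j)%R <= s.+1.
  by rewrite (leq_trans (size_coef_lagrange _ _ _))//; lia.
have m1 : cost (mulX pmul f1 (vanishing (label r))) <= d * M s.
  by apply: cost_mulX => //; rewrite size_vanishing; lia.
have m2 : cost (mulX pmul f2 (vanishing (label l))) <= d * M s.
  by apply: cost_mulX => //; rewrite size_vanishing; lia.
have mulX_size (f : {poly {poly F}}) (S S' : {set F}) : s = #|S| + #|S'| ->
    size f <= d -> (forall j, size (f`_j)%R <= #|S|) ->
    size (f * (vanishing S')%:P)%R <= d /\
    forall j, size ((f * (vanishing S')%:P)%R`_j)%R <= s.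
  move=> sSS fd fS; split=> [|j].
    by rewrite mulrC mul_polyC (leq_trans (size_scale_leq _ _)).
  rewrite coefMC (leq_trans (size_polyMleq _ _))// size_vanishing.
  by have := fS j; lia.
have [g1d g1s] := mulX_size _ _ _ sE f1d (size_coef_lagrange _ _).
have [g2d g2s] := mulX_size _ _ _ (etrans sE (addnC _ _)) f2d (size_coef_lagrange _ _).
have a12 : cost (add2 g1 g2) <= d * s.
  by rewrite /g1 /g2 !result_mulX; apply: cost_add2.
have s_n : 0 < s <= n by lia.
have Ms := M_superlinear s_n.
have Mn : n <= M n by apply: M_ge; lia.
(* 3 + 2s + ds gathers the table accesses and the final addition; with the
   two products, which contribute 2 d M(s), this accounts for the 8. *)
have h1 : (3 + 2 * s + d * s) * n <= 6 * (d * s) * M n.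
  by apply: leq_mul => //; nia.
have h2 : d * M s * n <= d * (M n * s) by rewrite -mulnA leq_mul2l Ms orbT.
rewrite tree_size_node -/s.
move: cl cr m1 m2 a12 h1 h2 sE.
move: (cost (combine _ _ _ _)) (cost (combine _ _ _ _)) (cost (add2 _ _)).
move: (cost (mulX _ _ _)) (cost (mulX _ _ _)) (tree_size l) (tree_size r).
move: (#|label l|) (#|label r|) (M n) (M s) => sl sr Mn' Ms' tl tr m1 m2 c1 c2 a.
move=> c1E c2E m1E m2E aE h1 h2 sE.
apply: (@leq_trans (((3 + 2 * s + d * s) + (d * Ms' + d * Ms') + (c1 + c2)) * n)).
  by rewrite leq_mul2r; apply/orP; right; lia.
by rewrite !mulnDl in h1 *; rewrite !mulnDr; lia.
Qed.

End Combine.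

Section Interpolation.
Variable F : finFieldType.
Local Open Scope nat_scope.
Variables
  (pmul : forall F : finFieldType, {poly F} -> {poly F} -> prog {poly F})
  (umpe : forall F : finFieldType, {poly F} -> {set F} -> prog {fmap F -> F})
  (uinterp : forall F : finFieldType,
     {set F} -> {fmap F -> F} -> prog {poly F})
  (tvanish : forall F : finFieldType,
     ptree F -> prog {fmap {set F} -> {poly F}})
  (ptree_of : forall F : finFieldType, {set F} -> ptree F)
  (M T1 T2 T3 : nat -> nat).
Hypotheses
  (M_ge : forall n : nat, 0 < n -> n <= M n)
  (M_superlinear : forall k n : nat, 0 < k <= n -> M k * n <= M n * k)
  (T1_homo : {homo T1 : i j / i <= j}) (T2_homo : {homo T2 : i j / i <= j})
  (pmulE : forall g h : {poly F}, result (pmul g h) = (g * h)%R)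
  (pmul_cost : forall (g h : {poly F}) n,
     size g <= n.+1 -> size h <= n.+1 -> cost (pmul g h) <= M n)
  (umpeE : forall (h : {poly F}) (S : {set F}) a,
     (result (umpe h S)).[? a] = if a \in S then Some h.[a]%R else None)
  (umpe_cost : forall (h : {poly F}) (S : {set F}),
     cost (umpe h S) <= T1 ((size h).-1 + #|S|))
  (uinterp_spec : forall (S : {set F}) (V : {fmap F -> F}),
    (forall a : F, (a \in domf V) = (a \in S)) ->
    [/\ size (result (uinterp S V)) <= #|S|,
        forall a : F, a \in S -> V.[? a] = Some (result (uinterp S V)).[a]%R
      & cost (uinterp S V) <= T2 #|S|])
  (tvanish_spec : forall t : ptree F, balanced t ->
    (forall N : {set F}, (result (tvanish t)).[? N] =
         if N \in nodes t then Some (vanishing N) else None) /\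
    cost (tvanish t) <= T3 #|label t|)
  (ptree_spec : forall S : {set F}, S != finset.set0 ->
    label (ptree_of S) = S /\ balanced (ptree_of S)).

(** The hypotheses say that f has Y-degree less than the size of each column
    and X-degree less than the number of columns, so that it is determined by
    its values: first the columns determine each f(a, Y), then the abscissas
    determine f. The column heights may vary as long as they stay below s. *)
Lemma bivariate_interp_spec (f : {poly {poly F}}) (P : {set F * F})
    (V : {fmap F * F -> F}) (s d : nat) :
  P != finset.set0 ->
  (forall p, p \in P -> V.[? p] = Some (eval2 f p)) ->
  (forall a, a \in abscissas P -> size f <= #|fibre P a| <= s) ->
  (forall j, size (f`_j)%R <= #|abscissas P|) ->
  #|abscissas P| <= 2 ^ d ->
  let run := bivariate_interp pmul umpe uinterp tvanish ptree_of P V in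
  let n := #|abscissas P| in
  result run = f /\
  cost run <= 4 * #|P| + n * (2 + 2 * s + T2 s) + n * d.+1 + T3 n +
    (2 * n + 3) + T1 (2 * n) + n * (4 + s) + 8 * s * M n * d.+1.
Proof.
move=> P0 VE; set X := abscissas P => fP fX nd run n.
have [p0 p0P] : exists p, p \in P by apply/set0Pn.
have X0 : X != finset.set0 by apply/set0Pn; exists p0.1; apply: mem_abscissas.
have [XE YE cE] := coordinates_spec P; rewrite -/X in XE YE.
have [tX tb] := ptree_spec X0.
have [UE Uc] := tvanish_spec tb.
pose fs := tabulate (fun a =>
  let* Ya := read finset.set0 (result (coordinates P)).2 a in
  let* Va := tabulate (fun b => read 0%R V (a, b)) (enum Ya) in
  uinterp Ya Va) (enum X).
pose Va a := tabulate (fun b => read 0%R V (a, b)) (enum (fibre P a)).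
have VaE a b : (result (Va a)).[? b] =
    if b \in fibre P a then Some (evalX f a).[b]%R else None.
  rewrite result_tabulate mem_enum; case: ifP => // bP /=.
  by rewrite VE ?eval2E//; move: bP; rewrite inE.
have Va_dom a b : (b \in domf (result (Va a))) = (b \in fibre P a).
  by rewrite -fndSome VaE; case: ifP.
(* The Y-degree of f is small enough for f(a, Y) to be the interpolant. *)
have interp a : a \in X -> result (uinterp (fibre P a) (result (Va a))) = evalX f a.
  move=> aX; have [gs gE _] := uinterp_spec (Va_dom a).
  apply: (@poly_eq_on _ (fibre P a)) => // [|b bP].
    by case/andP: (fP a aX) => ? _; apply: leq_trans (size_evalX _ _) _.
  by apply: Some_inj; rewrite -gE// VaE bP.
have fsE a : a \in X -> (result fs).[? a] = Some (evalX f a).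
  by move=> aX; rewrite result_tabulate mem_enum aX /= YE//= interp.
have fsc : cost fs <= n * (2 + 2 * s + T2 s).
  rewrite cost_tabulate; apply: sum_enum_le => a aX; rewrite /= YE//=.
  have [_ _ c2] := uinterp_spec (Va_dom a).
  rewrite -/(Va a); have [/andP[_ /[dup] sa /T2_homo sT]] := fP a aX.
  have -> : cost (Va a) = 2 * #|fibre P a|.
    by rewrite cost_tabulate /= big_const_seq count_predT -cardE iter_addn_0.
  move: c2 sT sa; move: (cost _) (#|fibre P a|) => c k; lia.
have UXE : (result (tvanish (ptree_of X))).[? X] = Some (vanishing X).
  by rewrite UE -{1}tX label_nodes.
pose h := ((vanishing X)^`())%R.
pose W := tabulate (fun a =>
  let* fa := read 0%R (result fs) a in
  let* r := read 0%R (result (umpe h X)) a in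
  let* ri := ops 1 (r^-1)%R in
  ops (size fa) (ri *: fa)%R) (enum X).
have WE a : a \in label (ptree_of X) ->
    (result W).[? a] = Some ((h.[a])^-1 *: evalX f a)%R.
  rewrite tX => aX.
  by rewrite result_tabulate mem_enum aX /= fsE//= umpeE aX.
have Wc : cost W <= n * (4 + s).
  rewrite cost_tabulate; apply: sum_enum_le => a aX; rewrite /= fsE//=.
  have /andP[fa /(leq_trans fa) size_f] := fP a aX.
  by have := leq_trans (size_evalX f a) size_f; move: (size _) => k; lia.
have UE' N : N \in nodes (ptree_of X) ->
  (result (tvanish (ptree_of X))).[? N] = Some (vanishing N) by rewrite UE => ->.
have hc : cost (umpe h X) <= T1 (2 * n).
  apply: leq_trans (umpe_cost _ _) _; apply: T1_homo.
  rewrite mul2n -addnn leq_add2r; apply: leq_trans (leq_pred _) _.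
  apply: leq_trans (size_poly _ _) _.
  by rewrite size_vanishing.
have runE : result run = result (combine pmul (ptree_of X) (result W)
    (result (tvanish (ptree_of X)))).
  by rewrite /run /bivariate_interp /= XE UXE.
have runc : cost run = 4 * #|P| + (cost fs + (tree_size (ptree_of X) +
    (cost (tvanish (ptree_of X)) + (1 + (2 * (size (vanishing X)) +
    (cost (umpe h X) + (cost W + cost (combine pmul (ptree_of X) (result W)
    (result (tvanish (ptree_of X))))))))))).
  by rewrite -cE /run /bivariate_interp /= XE UXE.
(* The column of a point is nonempty. *)
have s0 : 0 < s.
  have /andP[_] := fP _ (mem_abscissas p0P); apply: leq_trans.
  by apply/card_gt0P; exists p0.2; rewrite inE -surjective_pairing.
have Wsize a : a \in label (ptree_of X) -> size ((h.[a])^-1 *: evalX f a)%R <= s.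
  rewrite tX => aX; have /andP[fa /(leq_trans fa) size_f] := fP a aX.
  by rewrite (leq_trans (size_scale_leq _ _))// (leq_trans (size_evalX _ _)).
split; first by rewrite runE (result_combine pmulE tb WE UE') tX lagrange_evalX.
have lX : #|label (ptree_of X)| <= n by rewrite tX.
have n0 : 0 < n by rewrite card_gt0.
have cc := cost_combine pmulE M_superlinear M_ge pmul_cost tb s0 lX WE Wsize UE'.
have := @tree_size_le _ _ d tb; rewrite tX => /(_ nd) ts.
have {}cc : cost (combine pmul (ptree_of X) (result W)
    (result (tvanish (ptree_of X)))) <= 8 * s * M n * d.+1.
  rewrite -(leq_pmul2r n0) (leq_trans cc)// -[leqRHS]mulnA leq_mul2l mulnC.
  by rewrite [d.+1 * n]mulnC ts orbT.
rewrite tX in Uc; rewrite runc size_vanishing.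
have total k p f1 t1 u1 h1 w1 c1 f2 t2 u2 h2 w2 c2 :
    f1 <= f2 -> t1 <= t2 -> u1 <= u2 -> h1 <= h2 -> w1 <= w2 -> c1 <= c2 ->
    p + (f1 + (t1 + (u1 + (1 + (2 * k.+1 + (h1 + (w1 + c1))))))) <=
    p + f2 + t2 + u2 + (2 * k + 3) + h2 + w2 + c2 by lia.
exact: total.
Qed.

End Interpolation.

(** * Pole orders at the place at infinity *)

Section Places.
Variables (F K : fieldType) (iota : {rmorphism F -> K}) (O : set K).
Hypothesis placeO : is_place iota O.

Let O_const a : O (iota a). Proof. by case: placeO. Qed.

Let O_sub u v : O u -> O v -> O (u - v).
Proof. by case: placeO => _ h _ _ Ou Ov; have [] := h _ _ Ou Ov. Qed.

Let O_mul u v : O u -> O v -> O (u * v).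
Proof. by case: placeO => _ h _ _ Ou Ov; have [] := h _ _ Ou Ov. Qed.

Let O_inv z : ~ O z -> O z^-1.
Proof. by case: placeO => _ _ h _; case: (h z). Qed.

Let O0 : O 0. Proof. by rewrite -(rmorph0 iota). Qed.

Let O1 : O 1. Proof. by rewrite -(rmorph1 iota). Qed.

Let O_opp u : O u -> O (- u).
Proof. by move=> Ou; rewrite -sub0r; apply: O_sub. Qed.

Let O_add u v : O u -> O v -> O (u + v).
Proof. by move=> Ou Ov; rewrite -(opprK v); apply/O_sub/O_opp. Qed.

Let O_exp u n : O u -> O (u ^+ n).
Proof. by move=> Ou; elim: n => [|n IHn]; rewrite ?expr0 ?exprS//; apply: O_mul. Qed.

Lemma pole_inv z : ~ O z -> max_ideal O z^-1.
Proof. by move=> Oz; split; [exact: O_inv | rewrite invrK]. Qed.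

Lemma pole_neq0 z : ~ O z -> z != 0.
Proof. by apply: contra_notN => /eqP->. Qed.

(** If z^(n+1) were regular at the place, then so would be
    z = z^(n+1) (1/z)^n, since 1/z is regular. *)
Lemma pole_exp z n : (0 < n)%N -> ~ O z -> ~ O (z ^+ n).
Proof.
case: n => // n _ Oz Ozn; apply: Oz.
have [->|z0] := eqVneq z 0; first exact: O0.
have [//|Oz] := pselect (O z).
have -> : z = z ^+ n.+1 * z^-1 ^+ n by rewrite exprS exprVn mulfK// expf_neq0.
by apply: O_mul => //; apply/O_exp/O_inv.
Qed.

Lemma max_ideal_mull u z : O u -> max_ideal O z -> max_ideal O (u * z).
Proof.
move=> Ou [Oz Ozi]; split; first exact: O_mul.
rewrite mulf_eq0 negb_or => /andP[u0 z0]; rewrite invfM => Ouz.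
by apply: (Ozi z0); rewrite -(mulVKf u0 z^-1); apply: O_mul.
Qed.

(** Of two nonzero elements, one divides the other in a valuation ring, so their
    sum is a multiple of one of them. *)
Lemma max_ideal_add z w : max_ideal O z -> max_ideal O w -> max_ideal O (z + w).
Proof.
have aux a b : max_ideal O b -> b != 0 -> O (a / b) -> max_ideal O (a + b).
  move=> mb b0 Oab; have -> : a + b = (a / b + 1) * b by rewrite mulrDl divfK ?mul1r.
  by apply: max_ideal_mull => //; apply: O_add.
move=> mz mw; have [->|z0] := eqVneq z 0; first by rewrite add0r.
have [->|w0] := eqVneq w 0; first by rewrite addr0.
have [|/O_inv] := pselect (O (z / w)); first exact: aux.
by rewrite invf_div addrC; apply: aux.
Qed.

Lemma max_ideal0 : max_ideal O 0.
Proof. by split => //; rewrite eqxx. Qed.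

(** This replaces the strict triangle inequality of valuations: a sum with a
    single term that is a unit cannot lie in the maximal ideal. *)
Lemma unit_add a s : O a^-1 -> a != 0 -> max_ideal O s ->
  a + s != 0 /\ O (a + s)^-1.
Proof.
move=> Oai a0 ms.
have nma : ~ max_ideal O a by case=> _ /(_ a0).
have mN : max_ideal O (- s) by rewrite -mulN1r; apply/max_ideal_mull/ms/O_opp.
have asP : ~ max_ideal O (a + s).
  by move=> mas; apply: nma; rewrite -(addrK s a); apply: max_ideal_add.
split; first by apply: contra_notN asP => /eqP->; exact: max_ideal0.
by apply: contrapT => /pole_inv; rewrite invrK.
Qed.

Section Hermitian.
Variables (q : nat) (x y : K).
Hypotheses (q_gt1 : (1 < q)%N) (x_pole : ~ O x)
  (xy_curve : y ^+ q + y = x ^+ q.+1).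

Let x0 : x != 0 := pole_neq0 x_pole.

Let y_pole : ~ O y.
Proof.
move=> Oy; have := pole_exp (ltn0Sn q) x_pole.
by rewrite -xy_curve; apply; apply: O_add => //; apply: O_exp.
Qed.

Let y0 : y != 0 := pole_neq0 y_pole.

(** Up to units, [u] plays the role of the inverse of a local parameter: [x] and
    [y] turn out to be its powers [q] and [q.+1], and [e] is the unit by which
    they differ. *)
Let u := y / x.

Let e := x / u ^+ q.

Let u0 : u != 0. Proof. by rewrite mulf_neq0 ?invr_neq0. Qed.

Let e0 : e != 0. Proof. by rewrite mulf_neq0 ?invr_neq0 ?expf_neq0. Qed.

Let xE : x = e * u ^+ q. Proof. by rewrite divfK// expf_neq0. Qed.

Let yE : y = e * u ^+ q.+1.
Proof. by rewrite exprSr mulrA -xE mulrC divfK. Qed.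

(** The curve equation gives 1/e = y^q / x^(q+1) = 1 - 1 / (y^(q-1) + 1), and
    the fraction lies in the maximal ideal because y has a pole and q > 1. *)
Let e_unit : O e /\ O e^-1.
Proof.
have [r qE] : exists r, q = r.+2 by exists q.-2; lia.
have s_pole : ~ O (y ^+ r.+1 + 1).
  move=> Oyr; apply: (@pole_exp y r.+1 isT y_pole).
  by rewrite -(addrK 1 (y ^+ r.+1)); apply: O_sub.
pose s := (y ^+ r.+1 + 1)^-1.
have ms : max_ideal O (- s).
  by rewrite -mulN1r; apply/max_ideal_mull/pole_inv/s_pole/O_opp.
have eV : e^-1 = 1 + - s.
  have yr0 := pole_neq0 s_pole.
  have -> : e^-1 = y ^+ q / x ^+ q.+1.
    by rewrite /e /u exprMn invf_div exprVn [x ^+ q.+1]exprSr invfM mulrA.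
  rewrite -xy_curve qE /s (exprS y r.+1).
  have -> : y * y ^+ r.+1 + y = y * (y ^+ r.+1 + 1) by rewrite mulrDr mulr1.
  rewrite -mulf_div divff// mul1r.
  by apply: (mulIf yr0); rewrite mulrBl divfK// mulVf// mul1r addrK.
have [] := @unit_add 1 (- s) _ (oner_neq0 _) ms; first by rewrite invr1.
rewrite -eV invrK => _ Oe; split => //.
by rewrite eV; apply: O_add => //; case: ms.
Qed.

Let u_pole : ~ O u.
Proof.
move=> Ou; apply: x_pole; rewrite xE; apply: O_mul; last exact: O_exp.
by case: e_unit.
Qed.

(** The pole order of x^i y^j measured in powers of u. *)
Definition weight (p : nat * nat) := (q * p.1 + q.+1 * p.2)%N.

(** The weight of (i, j) is congruent to j modulo q, and j < q. *)
Lemma weight_inj p p' : (p.2 < q)%N -> (p'.2 < q)%N ->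
  weight p = weight p' -> p = p'.
Proof.
case: p p' => [i j] [i' j']; rewrite /weight /= => jq j'q wE.
have jE : j = j'.
  have : ((i + j) * q + j = (i' + j') * q + j')%N by move: wE; lia.
  by move=> /(congr1 (modn^~ q)); rewrite !modnMDl !modn_small.
by move: wE; rewrite jE => /addIn /eqP; rewrite eqn_pmul2l; [move=> /eqP-> | lia].
Qed.

Lemma eval2_ext_coef (f : {poly {poly F}}) (B : nat) :
  (size f <= q)%N -> (forall j, size (f`_j)%R <= B)%N ->
  eval2_ext iota f x y =
  \sum_(p : 'I_B * 'I_q) iota f`_p.2`_p.1 * (x ^+ p.1 * y ^+ p.2).
Proof.
move=> fq fB; rewrite -(pair_bigA _ (fun (i : 'I_B) (j : 'I_q) =>
  iota f`_j`_i * (x ^+ i * y ^+ j))) exchange_big /=.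
rewrite /eval2_ext (@horner_coef_wide _ q (map_poly (map_poly iota) f)); last first.
  by rewrite (leq_trans (size_poly _ _)).
rewrite horner_sum; apply: eq_bigr => j _.
rewrite -polyC_exp hornerM hornerC coef_map /= (@horner_coef_wide _ B); last first.
  by rewrite (leq_trans (size_poly _ _)).
by rewrite mulr_suml; apply: eq_bigr => i _; rewrite coef_map mulrA.
Qed.

(** Let N be the largest weight of a monomial of f. It is attained once, so f is
    a unit times u^N by [unit_add]. The element 1/(u t) is regular because 1/u
    lies in the maximal ideal; if N > m, multiplying its m-th power by t^m u^N
    would make u^(N-m) regular, although u has a pole. The place may a priori
    have no integer valuation in which t has order 1, but the argument only
    compares powers. *)
Lemma pole_order_bound (t : K) (m : nat) (f : {poly {poly F}}) :
  uniformizer O t -> (size f <= q)%N -> O (t ^+ m * eval2_ext iota f x y) ->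
  forall i j, f`_j`_i != 0 -> (weight (i, j) <= m)%N.
Proof.
move=> [t0 _ t_unif] fq Of i j fij.
pose B := (\max_(j < q) size (f`_j)%R)%N.
have fB k : (size (f`_k)%R <= B)%N.
  have [kq|qk] := ltnP k q; first exact: (leq_bigmax (Ordinal kq)).
  by rewrite nth_default ?size_poly0// (leq_trans fq).
have iB : (i < B)%N.
  by rewrite ltnNge; apply: contra fij => Bi; rewrite nth_default// (leq_trans (fB j)).
have jq : (j < q)%N.
  rewrite ltnNge; apply: contra fij => qj.
  by rewrite (nth_default 0 (leq_trans fq qj)) coef0.
pose c (p : 'I_B * 'I_q) := f`_p.2`_p.1.
pose wt (p : 'I_B * 'I_q) := weight (p.1 : nat, p.2 : nat).
pose p0 : 'I_B * 'I_q := (Ordinal iB, Ordinal jq).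
have cp0 : c p0 != 0 by [].
case: (@arg_maxnP _ p0 (fun p => c p != 0) wt cp0) => p cp p_max.
apply: leq_trans (p_max p0 cp0) _.
have [//|N_m] := leqP (wt p) m.
have u_max : max_ideal O u^-1 := pole_inv u_pole.
have Ouv : O u^-1 by case: u_max.
have [Oe Oei] := e_unit.
have mono (p' : 'I_B * 'I_q) :
    x ^+ p'.1 * y ^+ p'.2 = e ^+ (p'.1 + p'.2) * u ^+ wt p'.
  by rewrite {1}xE {1}yE !exprMn -!exprM /wt /weight /= !exprD; ring.
(* The term of index p is a unit after division by u^(wt p), and the others
   fall into the maximal ideal. *)
have ev : eval2_ext iota f x y = u ^+ wt p * (iota (c p) * e ^+ (p.1 + p.2) +
    \sum_(p' | p' != p) iota (c p') * (e ^+ (p'.1 + p'.2) * (u ^+ wt p' / u ^+ wt p))).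
  rewrite (eval2_ext_coef fq fB) (bigD1 p)//= mulrDr mono mulr_sumr.
  congr (_ + _); first by rewrite /c; ring.
  apply: eq_bigr => p' _; rewrite mono /c.
  rewrite [RHS]mulrC -!mulrA; congr (_ * (_ * _)).
  by rewrite mulVf ?mulr1// expf_neq0.
have [|||] := @unit_add (iota (c p) * e ^+ (p.1 + p.2)) (\sum_(p' | p' != p)
  iota (c p') * (e ^+ (p'.1 + p'.2) * (u ^+ wt p' / u ^+ wt p))).
- rewrite invfM; apply: O_mul; first by rewrite -fmorphV.
  by rewrite -exprVn; apply: O_exp.
- by rewrite mulf_neq0 ?expf_neq0// fmorph_eq0.
- apply: (big_ind (max_ideal O)) => [|a b|p' p'p]; [exact: max_ideal0| |].
    exact: max_ideal_add.
  have [->|cp'] := eqVneq (c p') 0; first by rewrite rmorph0 mul0r; exact: max_ideal0.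
  apply: max_ideal_mull => //; apply: max_ideal_mull; first exact: O_exp.
  have lt_wt : (wt p' < wt p)%N.
    have : (wt p' <= wt p)%N := p_max _ cp'.
    rewrite leq_eqVlt => /orP[/eqP wtE|//].
    have [/val_inj E1 /val_inj E2] :=
      @weight_inj (p'.1 : nat, p'.2 : nat) (p.1 : nat, p.2 : nat)
        (ltn_ord p'.2) (ltn_ord p.2) wtE.
    by move: p'p; rewrite -pair_eqE /pair_eq E1 E2 !eqxx.
  rewrite -(subnK lt_wt) exprD exprS invfM (invfM u).
  set k := (_ - _)%N; set n := wt p'.
  have -> : u ^+ n * ((u ^+ k)^-1 * (u^-1 * (u ^+ n)^-1)) =
    (u ^+ k)^-1 * u^-1 * (u ^+ n * (u ^+ n)^-1) by ring.
  rewrite mulfV ?expf_neq0// mulr1 -exprVn.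
  by apply: max_ideal_mull => //; apply: O_exp.
set s := _ + _ in ev *; move=> s0 Osi.
have Otu : O (t ^+ m * u ^+ wt p).
  by have := O_mul Of Osi; rewrite ev -!mulrA mulfV// mulr1.
have Oum : O (u^-1 / t) := t_unif _ u_max.
exfalso; apply: (@pole_exp u (wt p - m)); [by rewrite subn_gt0 | exact: u_pole |].
have := O_mul (O_exp m Oum) Otu.
have -> : u ^+ wt p = u ^+ (wt p - m) * u ^+ m by rewrite -exprD subnK// ltnW.
rewrite exprMn !exprVn.
have -> : (u ^+ m)^-1 / t ^+ m * (t ^+ m * (u ^+ (wt p - m) * u ^+ m)) =
  u ^+ (wt p - m) * ((u ^+ m)^-1 * u ^+ m) * ((t ^+ m)^-1 * t ^+ m) by ring.
by rewrite !mulVf ?expf_neq0// !mulr1.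
Qed.

End Hermitian.

End Places.

(** * Counting the points of the Hermitian curve *)

Section Fibres.
Variables (F : finFieldType) (q : nat).
Hypothesis q_prime_power : exists p k : nat, [/\ prime p, (0 < k)%N & q = (p ^ k)%N].
Hypothesis card_F : #|F| = (q ^ 2)%N.

Lemma prime_power_gt1 : (1 < q)%N.
Proof.
case: q_prime_power => p [k [/prime_gt1 p1 k0 ->]].
by rewrite -(exp1n k) ltn_exp2r.
Qed.

(** The exponent q is a power of the characteristic, as the field has q^2
    elements. *)
Lemma exprD_q (a b : F) : (a + b) ^+ q = a ^+ q + b ^+ q.
Proof.
have [p [k [pp k0 qE]]] := q_prime_power.
apply: exprDn_pchar; rewrite qE pnatX; apply/orP; left.
by rewrite pnatE// (@card_finPcharP _ _ (k * 2)%N)// card_F qE expnM.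
Qed.

Lemma expf_q2 (a : F) : (a ^+ q) ^+ q = a.
Proof. by rewrite -exprM mulnn -card_F expf_card. Qed.

(** A fibre of the trace from the field with q^2 elements to its subfield with q
    elements. *)
Definition trace_fibre (c : F) : {set F} := [set b | b ^+ q + b == c]%SET.

(** The subfield with q elements. *)
Definition frob_fixed : {set F} := [set c | c ^+ q == c]%SET.

Lemma card_trace_fibre_le c : (#|trace_fibre c| <= q)%N.
Proof.
have q1 := prime_power_gt1.
have sz : size ('X^q + ('X - c%:P) : {poly F}) = q.+1.
  by rewrite size_polyDl size_polyXn// size_XsubC.
rewrite -ltnS -sz; apply: card_roots_le => [|b].
  by rewrite -size_poly_gt0 sz.
by rewrite inE rootE !hornerE /= subr_eq0.
Qed.

Lemma card_frob_fixed_le : (#|frob_fixed| <= q)%N.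
Proof.
have q1 := prime_power_gt1.
have sz : size ('X^q - 'X : {poly F}) = q.+1.
  by rewrite size_polyDl size_polyXn// size_polyN size_polyX.
rewrite -ltnS -sz; apply: card_roots_le => [|b].
  by rewrite -size_poly_gt0 sz.
by rewrite inE rootE !hornerE /= subr_eq0.
Qed.

(** The trace fibres over the at most q fixed elements cover q^2 elements, and
    none has more than q; so none has fewer. *)
Lemma card_trace_fibre c : c \in frob_fixed -> #|trace_fibre c| = q.
Proof.
move=> cF; apply/eqP; rewrite eqn_leq card_trace_fibre_le /=.
have : (#|F| <= \sum_(d in frob_fixed) #|trace_fibre d|)%N.
  rewrite -sum1_card (partition_big (fun b : F => b ^+ q + b) (mem frob_fixed)) /=.
    apply: leq_sum => d _; rewrite sum1dep_card; apply: eq_leq; apply: eq_card => b.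
    by rewrite !inE.
  by move=> b _; rewrite inE exprD_q expf_q2 addrC.
rewrite card_F (bigD1 c cF) /= => le1.
have le2 : (\sum_(d in frob_fixed | d != c) #|trace_fibre d| <= q.-1 * q)%N.
  apply: (@leq_trans (\sum_(d in frob_fixed :\ c) q)%N).
    rewrite [leqRHS](eq_bigl (fun d => (d \in frob_fixed) && (d != c))); last first.
      by move=> d; rewrite in_setD1 andbC.
    by apply: leq_sum => d _; apply: card_trace_fibre_le.
  rewrite sum_nat_const leq_mul2r; apply/orP; right.
  by have := card_frob_fixed_le; rewrite (cardsD1 c) cF; lia.
have := leq_trans le1 (leq_add (leqnn _) le2); have := prime_power_gt1.
by case: q => // r _; rewrite /= -mulnn; lia.
Qed.

Lemma mem_hermitian_points (a b : F) :
  ((a, b) \in hermitian_points F q) = (b ^+ q + b == a ^+ q.+1).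
Proof.
by rewrite inE /eval2 /hermitian_poly !hornerE /= subr_eq0.
Qed.

(** The norm a^(q+1) lies in the subfield with q elements. *)
Lemma card_hermitian_fibre (a : F) :
  #|[set b | (a, b) \in hermitian_points F q]%SET| = q.
Proof.
rewrite -[RHS](@card_trace_fibre (a ^+ q.+1)).
  by apply: eq_card => b; rewrite [LHS]inE [RHS]inE mem_hermitian_points.
by rewrite inE exprSr exprMn expf_q2 mulrC.
Qed.

Lemma card_hermitian_points : #|hermitian_points F q| = (q ^ 3)%N.
Proof.
rewrite -sum1_card (eq_bigr (fun=> 1)%N)//.
rewrite (partition_big (fun p : F * F => p.1) predT)//=.
rewrite (eq_bigr (fun=> q)) => [|a _]; last first.
  rewrite sum1dep_card -[RHS](card_hermitian_fibre a).
  rewrite -[RHS](card_imset _ (fun b b' (e : (a, b) = (a, b')) => congr1 snd e)).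
  apply: eq_card => -[a' b]; rewrite [LHS]inE /=.
  apply/andP/imsetP => [[abP /eqP <-]|[b' + [-> ->]]].
    by exists b => //; rewrite inE.
  by rewrite inE eqxx => ->.
by rewrite sum_nat_const card_F -expnSr.
Qed.

End Fibres.

(** * Asymptotic estimates *)

Section Asymptotics.
Local Open Scope classical_set_scope.
Local Open Scope ring_scope.
Variables (R : realType) (M : nat -> nat).

(** Indices that are not parameters of a code do not matter for the filter. *)
Lemma class_O_codes (h t : code_params -> R) (K : R) :
  (forall C : hermitian_code, `|t (params C)| <= K * `|h (params C)|) ->
  class_O n_oo h t.
Proof.
move=> tK; apply/eqO_exP; exists (Num.max K 1); first by rewrite lt_max ltr01 orbT.
exists 0%N => // p [_ [C <-]]; apply: le_trans (tK C) _.
by rewrite ler_wpM2r// le_max lexx.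
Qed.

Lemma class_O_codes_le (h1 h2 : code_params -> R) (K : R) :
  (forall C : hermitian_code, `|h1 (params C)| <= K * `|h2 (params C)|) ->
  class_O n_oo h1 `<=` class_O n_oo h2.
Proof.
move=> hK t /eqO_exP[k k0 [N _ tk]]; apply/eqO_exP.
exists (k * Num.max K 1); first by rewrite mulr_gt0// lt_max ltr01 orbT.
exists N => // p [Np [C Cp]]; apply: le_trans (tk p _) _; first by split=> //; exists C.
rewrite -mulrA ler_pM2l// -Cp; apply: le_trans (hK C) _.
by rewrite ler_wpM2r// le_max lexx.
Qed.

(** The finitely many exceptions are absorbed by an additive constant. *)
Lemma class_O_eventually_bound (h t : nat -> R) :
  class_O eventually_filterType h t ->
  exists2 C : R, 0 <= C & forall k, `|t k| <= C * `|h k| + C.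
Proof.
move=> /eqO_exP[c c0 [N _ tc]].
pose D := \sum_(i < N) `|t i|.
have D0 : 0 <= D by apply: sumr_ge0.
exists (c + D) => [|k]; first by rewrite addr_ge0// ltW.
have [Nk|kN] := leqP N k.
  apply: le_trans (tc k Nk) _; rewrite mulrDl -addrA lerDl.
  by rewrite !addr_ge0 ?mulr_ge0// ltW.
apply: (@le_trans _ _ D); last by rewrite addrA lerDr addr_ge0 ?mulr_ge0 ?addr_ge0// ltW.
by rewrite /D (bigD1 (Ordinal kN))//= lerDl sumr_ge0.
Qed.

Lemma ln2_ge : 2^-1 <= ln 2 :> R.
Proof.
rewrite -ler_expR lnK ?posrE//.
have := @expR_ge1Dx R (- 2^-1); rewrite expRN => h.
have e0 := expR_gt0 (2^-1 : R).
have : (1 - 2^-1) * expR 2^-1 <= (expR 2^-1)^-1 * expR 2^-1 :> R.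
  by rewrite ler_pM2r.
by rewrite mulVf ?gt_eqF//; lra.
Qed.

Lemma ln_nat_ge0 (n : nat) : 0 <= ln n%:R :> R.
Proof. by case: n => [|n]; [rewrite ln0 | rewrite ln_ge0// ler1n]. Qed.

Lemma ler_ln_nat (k n : nat) : (k <= n)%N -> ln k%:R <= ln n%:R :> R.
Proof.
case: k => [|k] kn; first by rewrite ln0// ln_nat_ge0.
by rewrite ler_ln ?posrE ?ltr0n ?ler_nat// (leq_trans _ kn).
Qed.

Lemma ln_exp_nat (n k : nat) : ln (n ^ k)%N%:R = k%:R * ln n%:R :> R.
Proof.
case: n => [|n]; last by rewrite natrX lnXn ?ltr0n// mulr_natl.
case: k => [|k]; first by rewrite expn0 ln1 mul0r.
by rewrite exp0n// ln0 ?mulr0.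
Qed.

Lemma ln_nat_ge1 (n : nat) : (4 <= n)%N -> 1 <= ln n%:R :> R.
Proof.
move=> n4; apply: le_trans (ler_ln_nat n4).
by have := @ln_exp_nat 2 2; have := ln2_ge; rewrite [(2 ^ 2)%N]/= => h ->; lra.
Qed.

(** Cube 1 + ln n / 3 <= exp (ln n / 3). *)
Lemma ln_cube_le (n : nat) : (0 < n)%N -> ln n%:R ^+ 3 <= 27 * n%:R :> R.
Proof.
move=> n0; have n0R : 0 < n%:R :> R by rewrite ltr0n.
have l0 := ln_nat_ge0 n; set l := ln _ in l0 *.
have : (l / 3) ^+ 3 <= n%:R.
  rewrite -[leRHS](lnK n0R) -/l.
  have -> : expR l = expR (l / 3) ^+ 3 by rewrite -expRM_natl; congr expR; field.
  rewrite lerXn2r ?nnegrE ?expR_ge0 ?divr_ge0//; last first.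
    by apply: le_trans (expR_ge1Dx _); lra.
lra.
Qed.

(** The left-hand side bounds the number of levels of a balanced tree with q^2
    leaves: such a tree has depth at most 2 (trunc_log 2 q + 1). *)
Lemma trunc_log_ln (q : nat) : (1 < q)%N ->
  ((2 * (trunc_log 2 q).+1).+1)%:R <= 10 * ln q%:R :> R.
Proof.
have -> t : ((2 * t.+1).+1 = 2 * t + 3)%N by lia.
move=> q1; have t1 : (1 <= trunc_log 2 q)%N by rewrite trunc_log_gt0 q1.
have : (trunc_log 2 q)%:R * ln 2 <= ln q%:R :> R.
  by rewrite -ln_exp_nat; apply/ler_ln_nat/trunc_logP; rewrite ?(ltnW q1).
have := ln2_ge; have : 1 <= (trunc_log 2 q)%:R :> R by rewrite ler1n.
rewrite natrD natrM; move: (_%:R) (ln 2) => t l t_ge1 l_ge; nra.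
Qed.

Hypothesis hM : multiplication_time R M.

Lemma mul_time_superlinear (k n : nat) : (0 < k <= n)%N -> (M k * n <= M n * k)%N.
Proof. by case: hM => _ + _; apply. Qed.

Lemma mul_time_ge (n : nat) : (0 < n)%N -> (n <= M n)%N.
Proof.
move=> n0; have := @mul_time_superlinear 1 n n0; rewrite muln1; case: hM => M1 _ _.
by apply: leq_trans; rewrite leq_pmull.
Qed.

Lemma mul_time_homo (k n : nat) : (0 < k)%N -> (k <= n)%N -> (M k <= M n)%N.
Proof.
move=> k0 kn; have := @mul_time_superlinear k n; rewrite k0 kn => /(_ isT) h.
rewrite -(leq_pmul2r (leq_trans k0 kn)); apply: leq_trans h _.
by rewrite leq_mul2l kn orbT.
Qed.

(** Subproblems are never more expensive than the problem of their total size,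
    because M(k) / k is nondecreasing. *)
Lemma mul_time_scale (s c k n : nat) : (0 < k <= n)%N -> (s * k <= c * n)%N ->
  (s * M k <= c * M n)%N.
Proof.
move=> kn skn; have n0 : (0 < n)%N by case/andP: kn; apply: leq_trans.
have h := mul_time_superlinear kn.
rewrite -(leq_pmul2r n0) -mulnA (leq_trans (leq_mul (leqnn s) h))//.
by rewrite mulnCA [X in (_ <= X)%N]mulnAC [X in (_ <= X)%N]mulnC leq_mul2l skn orbT.
Qed.

(** For n >= 4 one has ln n >= 1, so that 0 <= ln (ln n) <= ln n and the
    additive constant is dominated by n (ln n)^2. *)
Lemma mul_time_quasilinear : exists2 C : R, 0 <= C &
  forall n, (4 <= n)%N -> (M n)%:R <= C * (n%:R * ln n%:R ^+ 2).
Proof.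
have [C C0 MC] : exists2 C : R, 0 <= C &
    forall n, `|(M n)%:R : R| <= C * `|n%:R * ln n%:R * ln (ln n%:R)| + C.
  by apply: class_O_eventually_bound; case: hM.
exists (2 * C) => [|n n4]; first by rewrite mulr_ge0.
have := MC n; rewrite ger0_norm//.
have l1 := ln_nat_ge1 n4; set l := ln n%:R in l1 *.
have n1 : 1 <= n%:R :> R by rewrite ler1n (leq_trans _ n4).
have l0 : 0 <= l by apply: le_trans l1.
have ll0 : 0 <= ln l by rewrite ln_ge0.
have ll : ln l <= l.
  have /le_ln1Dx : -1 < l - 1 by lra.
  by rewrite addrC subrK => ?; lra.
rewrite ger0_norm ?mulr_ge0// => MnC; apply: le_trans MnC _.
have h1 : n%:R * l * ln l <= n%:R * l ^+ 2.
  by rewrite expr2 mulrA ler_wpM2l// mulr_ge0.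
have h2 : 1 <= n%:R * l ^+ 2 by apply: mulr_ege1 => //; exact: exprn_ege1.
nra.
Qed.

Definition quasi_time (k : nat) : R := (M k)%:R * ln k%:R.

Lemma quasi_time_ge0 k : 0 <= quasi_time k.
Proof. by rewrite mulr_ge0 ?ln_nat_ge0. Qed.

Lemma quasi_time_homo : {homo quasi_time : k n / (k <= n)%N >-> k <= n}.
Proof.
move=> [|k] n kn; first by rewrite /quasi_time ln0// mulr0 quasi_time_ge0.
by rewrite ler_pM ?ln_nat_ge0 ?ler_ln_nat// ler_nat mul_time_homo.
Qed.

(** The given bound T need not be monotone, and costs are bounded by T at varying
    arguments; its explicit majorant is monotone and still natural-valued after
    truncation. *)
Lemma quasi_multiplication_bound (T : nat -> nat) :
  quasi_multiplication R M T ->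
  exists (T' : nat -> nat) (C : R), [/\ forall k, (T k <= T' k)%N,
    {homo T' : k n / (k <= n)%N}, 0 <= C
    & forall k, (T' k)%:R <= C * quasi_time k + C].
Proof.
move=> /class_O_eventually_bound[C C0 TC].
have b0 k : 0 <= C * quasi_time k + C.
  by apply: addr_ge0 => //; apply: mulr_ge0 => //; exact: quasi_time_ge0.
exists (fun k => Num.truncn (C * quasi_time k + C)), C; split => // [k|k n kn|k].
- rewrite truncn_ge_nat//; have := TC k.
  by rewrite ger0_norm// ger0_norm ?quasi_time_ge0.
- by apply: le_truncn; rewrite lerD2r ler_wpM2l// quasi_time_homo.
- by rewrite truncn_le.
Qed.

Lemma quasi_time_scale (s c k n : nat) : (0 < k <= n)%N -> (s * k <= c * n)%N ->
  s%:R * quasi_time k <= c%:R * quasi_time n.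
Proof.
move=> kn skn; rewrite /quasi_time !mulrA -!natrM ler_pM ?ln_nat_ge0//.
  by rewrite ler_nat mul_time_scale.
by case/andP: kn => _ /ler_ln_nat.
Qed.

(** Here n = q^3, and the quantity on the left is the cost of the evaluation
    algorithm with f_j of degree at most m / q. The two evaluation phases have
    total sizes at most m + n and 2 n. *)
Lemma encoding_cost_bound (T : nat -> nat) (C : R) : 0 <= C ->
  (forall k, (T k)%:R <= C * quasi_time k + C) ->
  forall q m : nat, (1 < q)%N ->
  (7 * q ^ 3 + q * (T (m %/ q + q ^ 2) + 2) + q ^ 2 * (2 * q + 2 + T (2 * q)))%N%:R
    <= (13 + 5 * C) * quasi_time (m + q ^ 3).
Proof.
move=> C0 TC q m q1; set N := (m + q ^ 3)%N; set k := (m %/ q + q ^ 2)%N.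
have q0 : (0 < q)%N by apply: ltnW.
have q4 : (4 <= q ^ 2)%N by rewrite (@leq_exp2r 2 q 2).
have q23 : (q ^ 2 <= q ^ 3)%N by rewrite leq_exp2l.
have q12 : (q <= q ^ 2)%N by rewrite -{1}(expn1 q) leq_exp2l.
have qk : (q * k <= N)%N.
  by rewrite mulnDr -expnS leq_add2r mulnC leq_trunc_div.
have k0 : (0 < k)%N by rewrite addn_gt0 expn_gt0 q0 orbT.
have kN : (k <= N)%N by apply: leq_trans qk; rewrite leq_pmull.
have h1 : q%:R * quasi_time k <= 1%:R * quasi_time N.
  by apply: quasi_time_scale; rewrite ?k0 ?mul1n.
have h2 : (q ^ 2)%N%:R * quasi_time (2 * q) <= 2%:R * quasi_time N.
  apply: quasi_time_scale; last by rewrite mulnCA -expnSr leq_mul2l leq_addl orbT.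
  rewrite muln_gt0 q0 (leq_trans _ (leq_addl _ _))//.
  by rewrite expnS mulnC leq_mul2l (leq_trans _ q4)// orbT.
have q3h : (q ^ 3)%N%:R <= quasi_time N.
  have N4 : (4 <= N)%N by rewrite (leq_trans q4)// (leq_trans q23)// leq_addl.
  rewrite -[leLHS]mulr1 ler_pM ?ln_nat_ge1// ler_nat.
  by apply: leq_trans (mul_time_ge _); [exact: leq_addl | lia].
have {}q23 : (q ^ 2)%N%:R <= (q ^ 3)%N%:R :> R by rewrite ler_nat.
have {}q12 : q%:R <= (q ^ 2)%N%:R :> R by rewrite ler_nat.
have t1 := ler_wpM2l (ler0n R q) (TC k).
have t2 := ler_wpM2l (ler0n R (q ^ 2)) (TC (2 * q)%N).
have c1 := ler_wpM2l C0 h1; have c2 := ler_wpM2l C0 h2.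
have c3 := ler_wpM2l C0 q12; have c4 := ler_wpM2l C0 q23.
have c5 := ler_wpM2l C0 q3h.
have e3 : (q ^ 3)%N%:R = (q ^ 2)%N%:R * q%:R :> R by rewrite -natrM -expnSr.
have -> : (7 * q ^ 3 + q * (T k + 2) + q ^ 2 * (2 * q + 2 + T (2 * q)))%N%:R =
    7 * (q ^ 3)%N%:R + q%:R * ((T k)%:R + 2) +
    (q ^ 2)%N%:R * (2 * q%:R + 2 + (T (2 * q)%N)%:R) :> R.
  by move: (q ^ 3)%N (q ^ 2)%N (T k) (T (2 * q)%N) => a b y1 y2; ring.
rewrite e3 in q3h q23 c4 c5 *.
lra.
Qed.

(** The summands follow the instructions of the interpolation algorithm for q^2
    abscissas with q points above each, preceded by the reading of the codeword.
    The argument 2 q^2 of T1 comes from the evaluation of a derivative of degree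
    less than q^2 at q^2 points. *)
Lemma unencoding_cost_bound (T1 T2 T3 : nat -> nat) (C1 C2 C3 : R) :
  0 <= C1 -> 0 <= C2 -> 0 <= C3 ->
  (forall k, (T1 k)%:R <= C1 * quasi_time k + C1) ->
  (forall k, (T2 k)%:R <= C2 * quasi_time k + C2) ->
  (forall k, (T3 k)%:R <= C3 * quasi_time k + C3) ->
  exists K : R, forall q : nat, (1 < q)%N ->
  (2 * q ^ 3 + (4 * q ^ 3 + q ^ 2 * (2 + 2 * q + T2 q) +
     q ^ 2 * (2 * (trunc_log 2 q).+1).+1 + T3 (q ^ 2) + (2 * q ^ 2 + 3) +
     T1 (2 * q ^ 2) + q ^ 2 * (4 + q) +
     8 * q * M (q ^ 2) * (2 * (trunc_log 2 q).+1).+1))%N%:R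
    <= K * (q%:R * (M (q ^ 2))%:R * ln q%:R).
Proof.
move=> C1_ge0 C2_ge0 C3_ge0 TC1 TC2 TC3; have [C C0 MC] := mul_time_quasilinear.
exists (130 + 3 * C2 + 4 * C3 + (2916 * C + 2) * C1) => q q1.
set n := (q ^ 2)%N; set d := (2 * (trunc_log 2 q).+1)%N.
have q0 : (0 < q)%N by apply: ltnW.
have n4 : (4 <= n)%N by rewrite (@leq_exp2r 2 q 2).
have n0 : (0 < n)%N by apply: leq_trans n4.
set l := ln q%:R : R.
have l2 : 2^-1 <= l by apply: le_trans ln2_ge _; apply: ler_ln_nat.
set A := q%:R * (M n)%:R : R; set h := A * l.
have q3A : (q ^ 3)%N%:R <= A by rewrite expnS natrM ler_wpM2l// ler_nat mul_time_ge.
have A0 : 0 <= A by apply: le_trans q3A.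
have q3h : (q ^ 3)%N%:R <= 2 * h by rewrite /h; nra.
have nq3 : n%:R <= (q ^ 3)%N%:R :> R by rewrite ler_nat leq_exp2l.
have q1n : 1 <= (q ^ 3)%N%:R :> R by rewrite ler1n expn_gt0 q0.
have dl : (d.+1)%:R <= 10 * l := trunc_log_ln q1.
have e3 : n%:R * q%:R = (q ^ 3)%N%:R :> R by rewrite -natrM -expnSr.
have nd : n%:R * (d.+1)%:R <= 10 * h.
  have : n%:R * (d.+1)%:R <= A * (10 * l).
    by rewrite ler_pM// (le_trans nq3).
  by rewrite /h; lra.
have Ad : A * (d.+1)%:R <= 10 * h by have := ler_wpM2l A0 dl; rewrite /h; lra.
have t2 : n%:R * quasi_time q <= h.
  rewrite /n expnS expn1 natrM -mulrA /h /A -/n -mulrA ler_wpM2l// /quasi_time mulrA.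
  rewrite -natrM ler_wpM2r ?ln_nat_ge0// ler_nat -[leqRHS]mul1n.
  by apply: mul_time_scale; rewrite ?mul1n ?mulnn// q0 -{1}(expn1 q) leq_exp2l.
have t3 : quasi_time n <= 2 * h.
  rewrite /quasi_time ln_exp_nat -/l mulrCA ler_wpM2l// /h /A -[leLHS]mul1r -mulrA.
  by rewrite ler_wpM2r ?mulr_ge0 ?ler1n//; lra.
(* M(2 q^2) is not controlled by M(q^2), so the upper bound on M is used:
   from ln (2 q^2) <= 3 ln q and (ln q)^3 <= 27 q one gets the factor
   2 * 27 * 27 = 1458. *)
have t1 : quasi_time (2 * n) <= 1458 * C * (q ^ 3)%N%:R.
  have n2 : (4 <= 2 * n)%N by rewrite (leq_trans n4)// leq_pmull.
  set l' := ln (2 * n)%N%:R : R; have l'0 : 0 <= l' := ln_nat_ge0 _.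
  have ll' : l' <= 3 * l.
    by rewrite -(@ln_exp_nat q 3); apply: ler_ln_nat; rewrite expnS leq_mul2r q1 orbT.
  have : quasi_time (2 * n) <= C * ((2 * n)%N%:R * l' ^+ 2) * l'.
    by rewrite ler_wpM2r// MC.
  have l'3 : l' ^+ 3 <= 729 * q%:R.
    have : l' ^+ 3 <= (3 * l) ^+ 3 by rewrite lerXn2r// nnegrE//; lra.
    by have := ln_cube_le q0; rewrite -/l; lra.
  have n2C : 0 <= C * (2 * n)%N%:R by rewrite mulr_ge0.
  have := ler_wpM2l n2C l'3; rewrite -e3 natrM; move: (quasi_time _) => x; lra.
have B1 : (T1 (2 * n)%N)%:R <= (2916 * C + 2) * C1 * h.
  apply: le_trans (TC1 _) _.
  have := ler_wpM2l C1_ge0 t1; have := ler_wpM2l C1_ge0 (le_trans q1n q3h).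
  have := ler_wpM2l (mulr_ge0 C1_ge0 C0) q3h; clear; lra.
have B2 : n%:R * (T2 q)%:R <= 3 * C2 * h.
  apply: le_trans (ler_wpM2l (ler0n R n) (TC2 q)) _.
  have := ler_wpM2l C2_ge0 t2; have := ler_wpM2l C2_ge0 (le_trans nq3 q3h).
  clear; lra.
have B3 : (T3 n)%:R <= 4 * C3 * h.
  apply: le_trans (TC3 n) _.
  have := ler_wpM2l C3_ge0 t3; have := ler_wpM2l C3_ge0 (le_trans q1n q3h).
  clear; lra.
have castE (a y1 y2 y3 b c e k : nat) :
    (2 * a + (4 * a + k * (2 + 2 * e + y2) + k * c + y3 + (2 * k + 3) + y1 +
     k * (4 + e) + 8 * e * b * c))%N%:R =
    6 * a%:R + 2 * k%:R + 2 * (k%:R * e%:R) + k%:R * y2%:R + k%:R * c%:R + y3%:R +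
    (2 * k%:R + 3) + y1%:R + (4 * k%:R + k%:R * e%:R) + 8 * (e%:R * b%:R * c%:R) :> R.
  by ring.
rewrite castE e3 -/A -/l -/h.
have -> : (130 + 3 * C2 + 4 * C3 + (2916 * C + 2) * C1) * h =
  130 * h + 3 * C2 * h + 4 * C3 * h + (2916 * C + 2) * C1 * h by rewrite 3!mulrDl.
have nh := le_trans nq3 q3h; have oneh := le_trans q1n q3h.
move: B1 B2 B3 Ad nd nh oneh q3h.
move: (_ * C1 * h) (_ * C2 * h) (_ * C3 * h) (A * _) (n%:R * d.+1%:R).
move=> k1 k2 k3 x y; clear; lra.
Qed.

(** Since m < n, m + n <= 2 n <= n^2, so ln (m + n) <= 2 ln n. *)
Lemma encoding_cost_soft : exists K : R, forall m n : nat, (4 <= n)%N -> (m < n)%N ->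
  quasi_time (m + n) <= K * (n%:R * ln n%:R ^+ 3).
Proof.
have [C C0 MC] := mul_time_quasilinear.
exists (16 * C) => m n n4 mn; set N := (m + n)%N.
have N2 : (N <= 2 * n)%N by rewrite mul2n -addnn leq_add2r ltnW.
have lN : ln N%:R <= 2 * ln n%:R :> R.
  rewrite -(@ln_exp_nat n 2); apply: ler_ln_nat.
  by rewrite (leq_trans N2)// -mulnn leq_mul2r (leq_trans _ n4) ?orbT.
have lN0 : 0 <= ln N%:R :> R := ln_nat_ge0 _.
have l0 : 0 <= ln n%:R :> R := ln_nat_ge0 _.
have : quasi_time N <= C * (N%:R * ln N%:R ^+ 2) * ln N%:R.
  by rewrite ler_wpM2r// MC// (leq_trans n4)// leq_addl.
have : C * (N%:R * ln N%:R ^+ 3) <= C * (2 * n%:R * (2 * ln n%:R) ^+ 3).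
  rewrite ler_wpM2l// ler_pM ?exprn_ge0//; first by rewrite -natrM ler_nat.
  by rewrite lerXn2r// nnegrE mulr_ge0.
move: (quasi_time _) => x; clear; lra.
Qed.

Lemma unencoding_cost_soft : exists K : R, forall q : nat, (1 < q)%N ->
  q%:R * (M (q ^ 2))%:R * ln q%:R <= K * ((q ^ 3)%N%:R * ln (q ^ 3)%N%:R ^+ 3).
Proof.
have [C C0 MC] := mul_time_quasilinear.
exists (4 * C) => q q1.
have l0 : 0 <= ln q%:R :> R := ln_nat_ge0 _.
have lq : ln q%:R ^+ 3 <= ln (q ^ 3)%N%:R ^+ 3 :> R.
  rewrite lerXn2r ?nnegrE ?ln_nat_ge0//; apply: ler_ln_nat.
  by rewrite -{1}(expn1 q) leq_exp2l.
have := MC (q ^ 2)%N; rewrite (@leq_exp2r 2 q 2) // q1 => /(_ isT).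
rewrite ln_exp_nat => Mq.
have ql0 : 0 <= q%:R * ln q%:R :> R by rewrite mulr_ge0.
have q3C : 0 <= 4 * C * (q ^ 3)%N%:R by rewrite !mulr_ge0.
have := ler_wpM2l ql0 Mq; have := ler_wpM2l q3C lq.
rewrite expnS natrM; move: (M _)%:R (ln (_ * _)) => x y; clear; lra.
Qed.

End Asymptotics.

(** * Parameters and messages of a Hermitian code *)

Section Codes.
Variable C : hermitian_code.
Local Open Scope nat_scope.

Let q_gt1 : 1 < hq C := prime_power_gt1 (hq_prime_power C).

Let card_points := card_hermitian_points (hq_prime_power C) (hF_card C).

Let card_fibre := card_hermitian_fibre (hq_prime_power C) (hF_card C).

Lemma code_length : hn C = hq C ^ 3.
Proof.
rewrite -card_points -(size_tuple (hP C)) -(card_uniqP (hP_uniq C)).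
by apply: eq_card => p; rewrite hP_points.
Qed.

Lemma abscissas_hermitian_points :
  abscissas (hermitian_points (hF C) (hq C)) = [set: hF C]%SET.
Proof.
apply/setP => a; rewrite inE; have := card_fibre a => fa.
have /card_gt0P[b bP] : 0 < #|fibre (hermitian_points (hF C) (hq C)) a|.
  by rewrite fa ltnW.
by apply: (@mem_abscissas _ _ (a, b)); move: bP; rewrite inE.
Qed.

(** The bound on pole orders applied to the leading monomial of each f_j. *)
Lemma message_coef_bound (f : {poly {poly hF C}}) : message f ->
  forall j, hq C * (size (f`_j)%R).-1 <= hm C.
Proof.
move=> [fq [_ [t t_unif tf]]] j.
have [_ xyE _] := h_function_field C.
have [->|fj0] := eqVneq (f`_j)%R 0%R; first by rewrite size_poly0 muln0.
have curve : (hy C ^+ hq C + hy C = hx C ^+ (hq C).+1)%R.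
  apply/eqP; rewrite -subr_eq0 -[X in _ == X]xyE; apply/eqP.
  rewrite /eval2_ext /hermitian_poly !(rmorphB, rmorphD) /= map_polyXn map_polyX.
  by rewrite map_polyC /= map_polyXn !hornerE.
have := pole_order_bound (hPoo_place C) q_gt1 (@hPoo_pole C) curve t_unif fq tf.
move=> /(_ (size (f`_j)%R).-1 j); rewrite -/(lead_coef _) lead_coef_eq0 fj0.
by move=> /(_ isT); apply: leq_trans; exact: leq_addr.
Qed.

Lemma message_coef_size (f : {poly {poly hF C}}) : message f ->
  forall j, size (f`_j)%R <= hq C ^ 2.
Proof.
move=> /message_coef_bound fm j; have := leq_ltn_trans (fm j) (hm_lt_hn C).
rewrite code_length expnS ltn_mul2l => /andP[_].
by case: (size _) => // k; rewrite ltnS.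
Qed.

End Codes.

Local Open Scope classical_set_scope.
Local Open Scope ring_scope.

Theorem corollaryV6 (R : realType) (M : nat -> nat)
  (pmul : forall F : finFieldType, {poly F} -> {poly F} -> prog {poly F})
  (umpe : forall F : finFieldType, {poly F} -> {set F} -> prog {fmap F -> F})
  (uinterp : forall F : finFieldType,
     {set F} -> {fmap F -> F} -> prog {poly F})
  (tvanish : forall F : finFieldType,
     ptree F -> prog {fmap {set F} -> {poly F}})
  (ptree_of : forall F : finFieldType, {set F} -> ptree F)
  (hM : multiplication_time R M)
  (hpmul : poly_mul_spec M pmul)
  (humpe : univariate_mpe_spec R M umpe)
  (huinterp : univariate_interp_spec R M uinterp)
  (htvanish : tree_vanish_spec R M tvanish)
  (hptree : partition_tree_spec ptree_of) :
  let encoding_class := class_O n_oo (fun p : code_params =>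
    (M (pm p + pn p)%N)%:R * ln (pm p + pn p)%:R : R) in
  let unencoding_class := class_O n_oo (fun p : code_params =>
    (pq p)%:R * (M (pq p ^ 2)%N)%:R * ln (pq p)%:R : R) in
  let soft_n := class_softO n_oo (fun p : code_params => (pn p)%:R : R) in
  ((exists2 T : code_params -> R, encoding_class T &
      forall (C : hermitian_code) (f : {poly {poly hF C}}), message f ->
        let run := bivariate_mpe umpe f (hermitian_points (hF C) (hq C)) in
        (forall i : 'I_(hn C),
           (result run).[? tnth (hP C) i] = Some (encoding f 0 i)) /\
        (cost run)%:R <= T (params C)) /\
   encoding_class `<=` soft_n) /\
  ((exists2 T : code_params -> R, unencoding_class T &
      forall (C : hermitian_code) (c : 'rV[hF C]_(hn C)), codeword c ->
        let run := semi_grid_unencode pmul umpe uinterp tvanish ptree_of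
                     (hiota C) (hx C) (hy C) (hP C) c in
        (exists f : {poly {poly hF C}},
           [/\ message f, encoding f = c
             & result run = eval2_ext (hiota C) f (hx C) (hy C)]) /\
        (cost run)%:R <= T (params C)) /\
   unencoding_class `<=` soft_n).
Proof.
have [T1 quasi1 umpe_spec] := humpe; have [T2 quasi2 uinterp_spec] := huinterp.
have [T3 quasi3 tvanish_spec] := htvanish.
have [T1' [C1 [T1le T1homo C1_ge0 T1bound]]] := quasi_multiplication_bound hM quasi1.
have [T2' [C2 [T2le T2homo C2_ge0 T2bound]]] := quasi_multiplication_bound hM quasi2.
have [T3' [C3 [T3le T3homo C3_ge0 T3bound]]] := quasi_multiplication_bound hM quasi3.
have umpeE F h S a := (@umpe_spec F h S).1 a.
have umpe_cost F h S : (cost (umpe F h S) <= T1' ((size h).-1 + #|S|))%N.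
  exact: leq_trans (umpe_spec F h S).2 (T1le _).
move=> encoding_class unencoding_class soft_n.
have class_scale (h : code_params -> R) K :
    class_O n_oo h (fun p => K * h p).
  by apply: (@class_O_codes _ _ _ `|K|) => C; rewrite normrM.
(* The exponent 3 collects the two logarithms of the bound on M and the one
   in the cost. *)
have soft_incl (h : code_params -> R) K :
    (forall C, 0 <= h (params C) <= K * ((hn C)%:R * ln (hn C)%:R ^+ 3)) ->
    class_O n_oo h `<=` soft_n.
  move=> hK t ht; exists 3%N => //.
  apply: (@class_O_codes_le _ _ _ K _ _ ht) => C.
  have /andP[h0 hC] := hK C.
  have n0 : 0 <= (hn C)%:R * ln (hn C)%:R ^+ 3 :> R.
    by apply: mulr_ge0 => //; apply: exprn_ge0; exact: ln_nat_ge0.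
  by rewrite (ger0_norm h0) /= (ger0_norm n0).
split; split.
- exists (fun p => (13 + 5 * C1) * quasi_time R M (pm p + pn p)).
    exact: class_scale.
  move=> C f fm run; have q1 := prime_power_gt1 (hq_prime_power C).
  have card_fibre := card_hermitian_fibre (hq_prime_power C) (hF_card C).
  split=> [i|].
    rewrite /run bivariate_mpe_correct ?mxE//.
    by rewrite -hP_points mem_tnth.
  rewrite /= code_length.
  apply: le_trans (encoding_cost_bound hM C1_ge0 T1bound (hm C) q1).
  rewrite ler_nat.
  have := @cost_bivariate_mpe _ umpe f (hermitian_points (hF C) (hq C)) T1' (hq C)
    (hm C %/ hq C + hq C ^ 2)%N (2 * hq C)%N T1homo (@umpe_cost (hF C)) (ltnW q1)
    fm.1 _ _.
  rewrite abscissas_hermitian_points cardsT (hF_card C).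
  rewrite (card_hermitian_points (hq_prime_power C) (hF_card C)); apply.
    move=> i; rewrite leq_add2r leq_divRL ?(ltnW q1)// mulnC.
    exact: message_coef_bound.
  by move=> a; rewrite /fibre card_fibre mul2n -addnn leq_add2r leq_pred.
- have [K softK] := encoding_cost_soft hM.
  apply: (@soft_incl _ K) => C.
  have n4 : (4 <= hn C)%N.
    rewrite code_length (@leq_trans (2 ^ 3))// leq_exp2r//.
    exact: prime_power_gt1 (hq_prime_power C).
  apply/andP; split; first exact: quasi_time_ge0.
  exact: softK n4 (hm_lt_hn C).
- have [K boundK] := unencoding_cost_bound hM C1_ge0 C2_ge0 C3_ge0 T1bound T2bound T3bound.
  exists (fun p => K * ((pq p)%:R * (M (pq p ^ 2)%N)%:R * ln (pq p)%:R)).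
    exact: class_scale.
  move=> C c [f fm ->] run; have q1 := prime_power_gt1 (hq_prime_power C).
  have card_fibre := card_hermitian_fibre (hq_prime_power C) (hF_card C).
  have PE : [set p in hP C]%SET = hermitian_points (hF C) (hq C).
    by apply/setP => p; rewrite -hP_points inE.
  (* The codeword is read into a table, where it becomes the evaluation table
     of the message. *)
  pose fill := foldp (fun V i => let* ci := ops 1 (encoding f 0 i) in
    write V (tnth (hP C) i) ci) [fmap] (enum 'I_(hn C)).
  have fillE p : p \in hermitian_points (hF C) (hq C) ->
      (result fill).[? p] = Some (eval2 f p).
    rewrite -hP_points => /tnthP[i ->].
    rewrite (@result_fill _ _ _ (tnth (hP C)) (eval2 f)) => [|j _]; last by rewrite /= mxE.
    by rewrite map_f ?mem_enum.
  have fill_cost : cost fill = (2 * hq C ^ 3)%N.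
    by rewrite cost_fill /= big_const_seq count_predT size_enum_ord iter_addn_0 code_length.
  have cX : #|abscissas (hermitian_points (hF C) (hq C))| = (hq C ^ 2)%N.
    by rewrite abscissas_hermitian_points cardsT (hF_card C).
  have points0 : hermitian_points (hF C) (hq C) != finset.set0.
    rewrite -card_gt0 (card_hermitian_points (hq_prime_power C) (hF_card C)).
    by rewrite expn_gt0 ltnW.
  have f_fibre a : a \in abscissas (hermitian_points (hF C) (hq C)) ->
      (size f <= #|fibre (hermitian_points (hF C) (hq C)) a| <= hq C)%N.
    by move=> _; rewrite /fibre card_fibre leqnn andbT; case: fm.
  have f_coef j : (size (f`_j)%R <= #|abscissas (hermitian_points (hF C) (hq C))|)%N.
    by rewrite cX; apply: message_coef_size.
  have depth : (#|abscissas (hermitian_points (hF C) (hq C))| <=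
      2 ^ (2 * (trunc_log 2 (hq C)).+1))%N.
    by rewrite cX mulnC expnM leq_exp2r// ltnW// trunc_log_ltn.
  have uinterpE (S : {set hF C}) (V : {fmap hF C -> hF C}) :
      (forall a, (a \in domf V) = (a \in S)) ->
      [/\ (size (result (uinterp _ S V)) <= #|S|)%N,
          forall a, a \in S -> V.[? a] = Some (result (uinterp _ S V)).[a]
        & (cost (uinterp _ S V) <= T2' #|S|)%N].
    by move=> /uinterp_spec[? ? /leq_trans-/(_ _ (T2le _))].
  have tvanishE (t : ptree (hF C)) : balanced t ->
      (forall N : {set hF C}, (result (tvanish _ t)).[? N] =
         if N \in nodes t then Some (vanishing N) else None) /\
      (cost (tvanish _ t) <= T3' #|label t|)%N.
    by move=> /tvanish_spec[? /leq_trans-/(_ _ (T3le _))].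
  have [runE run_cost] := @bivariate_interp_spec (hF C) pmul umpe uinterp tvanish
    ptree_of M T1' T2' T3' (mul_time_ge hM) (mul_time_superlinear hM) T1homo T2homo
    (fun g h => (hpmul _ g h).1) (fun g h => (hpmul _ g h).2)
    (@umpeE (hF C)) (@umpe_cost (hF C)) uinterpE tvanishE (hptree (hF C)) f
    _ _ _ _ points0 fillE f_fibre f_coef depth.
  have run_bind : run = Prog
      (eval2_ext (hiota C) (result (bivariate_interp pmul umpe uinterp tvanish
         ptree_of [set p in hP C]%SET (result fill))) (hx C) (hy C))
      (cost fill + (cost (bivariate_interp pmul umpe uinterp tvanish
         ptree_of [set p in hP C]%SET (result fill)) + 0))%N by [].
  rewrite run_bind PE; split; first by exists f; split => //=; rewrite runE.
  apply: le_trans (boundK _ q1); rewrite ler_nat /= addn0 fill_cost leq_add2l.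
  apply: leq_trans run_cost _; rewrite cX.
  by rewrite (card_hermitian_points (hq_prime_power C) (hF_card C)).
- have [K softK] := unencoding_cost_soft hM.
  apply: (@soft_incl _ K) => C; have q1 := prime_power_gt1 (hq_prime_power C).
  apply/andP; split; first by rewrite !mulr_ge0 ?ln_nat_ge0.
  by rewrite code_length; apply: softK.
Qed.
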